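(* Let $f\colon B\to A$ and $u\colon A\to B$ be functors of quasi-categories with $f\dashv u$ an adjunction of quasi-categories. Then there is a fibred equivalence over $A\times B$ between the objects $(p_1,p_0)\colon f\downarrow A\to A\times B$ and $(q_1,q_0)\colon B\downarrow u\to A\times B$.
   Context: A quasi-category is a simplicial set with fillers for all inner horns; functors are simplicial maps between quasi-categories. $\mathrm{qCat}_2$ is the strict 2-category of quasi-categories with hom-categories $\hom'(A,B)=h(B^A)$, where $B^A$ is the internal hom and $h\colon\mathrm{sSet}\to\mathrm{Cat}$ is left adjoint to the nerve. An adjunction of quasi-categories is an adjunction in $\mathrm{qCat}_2$ (unit $\eta\colon\mathrm{id}_B\Rightarrow uf$ and counit $\epsilon\colon fu\Rightarrow\mathrm{id}_A$ satisfying the triangle identities). Comma quasi-categories: $f\downarrow A$ is the pullback of $(\mathrm{cod},\mathrm{dom})\colon A^{\Delta^1}\to A\times A$ along $\mathrm{id}_A\times f\colon A\times B\to A\times A$, and $B\downarrow u$ is the pullback of $(\mathrm{cod},\mathrm{dom})\colon B^{\Delta^1}\to B\times B$ along $u\times\mathrm{id}_B\colon A\times B\to B\times B$; the projections to $A\times B$ are denoted $(p_1,p_0)$ and $(q_1,q_0)$, and both are isofibrations. Fibred equivalence: for isofibrations $p\colon E\to Q$, $q\colon F\to Q$ of quasi-categories, a fibred equivalence over $Q$ is a functor $w\colon E\to F$ with $qw=p$ for which there exist a functor $w'\colon F\to E$ with $pw'=q$ and isomorphisms $w'w\cong\mathrm{id}_E$ in $E^E$ and $\mathrm{id}_F\cong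 ww'$ in $F^F$ represented by 1-simplices whose composites with $p$ and $q$ respectively are degenerate. (A 1-simplex of a quasi-category is an isomorphism if it represents an isomorphism in the homotopy category.) This is the same as a functor over $Q$ that is an equivalence in $\mathrm{qCat}_2$. *)

(* Defs.v *)
From HB Require Import structures.
From mathcomp Require Import all_boot generic_quotient.
From mathcomp Require Import boolp.

Set Implicit Arguments.
Unset Strict Implicit.
Unset Printing Implicit Defensive.

Record category := Category {
  ob :> Type;
  hom : ob -> ob -> Type;
  idm : forall x, hom x x;
  comp : forall x y z, hom y z -> hom x y -> hom x z;
  comp1m : forall x y (f : hom x y), comp (idm y) f = f;
  compm1 : forall x y (f : hom x y), comp f (idm x) = f;
  compA : forall x y z t (h : hom z t) (g : hom y z) (f : hom x y),
    comp h (comp g f) = comp (comp h g) f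
}.
Arguments hom {c} x y.
Arguments idm {c} x.
Arguments comp {c x y z} g f.
Notation "g '∘m' f" := (comp g f) (at level 40, left associativity).

Definition iso_mor (C : category) (x y : C) (f : hom x y) : Prop :=
  exists g : hom y x, g ∘m f = idm x /\ f ∘m g = idm y.

Definition castm (C : category) (x x' y y' : C) (ex : x = x') (ey : y = y')
    (f : hom x y) : hom x' y' :=
  match ex in _ = a, ey in _ = b return hom a b with
  | erefl, erefl => f
  end.

Record functor (C D : category) := Functor {
  fob :> C -> D;
  fmap : forall x y : C, hom x y -> hom (fob x) (fob y);
  fmap1 : forall x : C, fmap (idm x) = idm (fob x);
  fmapM : forall (x y z : C) (g : hom y z) (f : hom x y),
    fmap (g ∘m f) = fmap g ∘m fmap f
}.
Arguments fmap {C D} F {x y} f : rename.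

Lemma functor_eq (C D : category) (F G : functor C D)
    (eob : forall x, F x = G x) :
  (forall x y (f : hom x y), castm (eob x) (eob y) (fmap F f) = fmap G f) ->
  F = G.
Proof.
case: F G eob => [Fo Fm F1 FM] [Go Gm G1 GM] /= eob.
have e : Fo = Go by apply: funext.
case: _ / e Gm G1 GM eob => Gm G1 GM eob efm.
have e : Fm = Gm.
  apply/functional_extensionality_dep => x; apply/functional_extensionality_dep => y.
  apply/functional_extensionality_dep => f; rewrite -efm.
  by rewrite (Prop_irrelevance (eob x) erefl) (Prop_irrelevance (eob y) erefl).
by case: _ / e G1 GM {efm} => G1 GM; congr Functor; exact: Prop_irrelevance.
Qed.

Definition functor_comp (C D E : category) (G : functor D E) (F : functor C D) :
  functor C E.
Proof.
refine (@Functor C E (fun x => G (F x)) (fun x y f => fmap G (fmap F f)) _ _).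
- by move=> x; rewrite !fmap1.
- by move=> x y z g f; rewrite !fmapM.
Defined.

(* [ordmap m n] is the hom-set from [m] = {0 < ... < m} to [n] of the simplex
   category. *)
Record ordmap (m n : nat) := OrdMap {
  omap :> 'I_m.+1 -> 'I_n.+1;
  omap_homo : {homo omap : i j / i <= j}
}.

Lemma ordmap_eq m n (f g : ordmap m n) : f =1 g -> f = g.
Proof.
case: f g => [f Hf] [g Hg] /= /funext e; case: _ / e Hg => Hg.
by congr OrdMap; exact: Prop_irrelevance.
Qed.

Definition ord_id n : ordmap n n := @OrdMap n n id (fun _ _ h => h).

Definition ord_comp m n p (g : ordmap n p) (f : ordmap m n) : ordmap m p :=
  @OrdMap m p (fun i => g (f i)) (fun _ _ h => omap_homo g (omap_homo f h)).

Definition ord_const m n (i : 'I_n.+1) : ordmap m n :=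
  @OrdMap m n (fun=> i) (fun _ _ _ => leqnn i).

Definition ord_edge_fun n (i j : 'I_n.+1) (k : 'I_2) : 'I_n.+1 :=
  if val k == 0 then i else j.

Lemma ord_edge_homo n (i j : 'I_n.+1) :
  i <= j -> {homo ord_edge_fun i j : k l / k <= l}.
Proof. by move=> ij [[|[|k]] //= hk] [[|[|l]] //= hl]. Qed.

Definition ord_edge n (i j : 'I_n.+1) (ij : i <= j) : ordmap 1 n :=
  OrdMap (ord_edge_homo ij).

Record sset := SSet {
  simp :> nat -> Type;
  act : forall m n, ordmap m n -> simp n -> simp m;
  act_id : forall n (x : simp n), act (ord_id n) x = x;
  act_comp : forall m n p (g : ordmap n p) (f : ordmap m n) (x : simp p),
    act (ord_comp g f) x = act f (act g x)
}.
Arguments act {s m n} a x : rename.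

Record smap (X Y : sset) := SMap {
  sapp :> forall n, X n -> Y n;
  snat : forall m n (a : ordmap m n) (x : X n), sapp (act a x) = act a (sapp x)
}.
Arguments sapp {X Y} s {n} x.

Lemma smap_eq (X Y : sset) (f g : smap X Y) :
  (forall n (x : X n), f n x = g n x) -> f = g.
Proof.
case: f g => [f Hf] [g Hg] /= e.
have {}e : f = g.
  by apply/functional_extensionality_dep => n; apply/funext => x; exact: e.
by case: _ / e Hg => Hg; congr SMap; exact: Prop_irrelevance.
Qed.

Definition sid (X : sset) : smap X X := @SMap X X (fun _ x => x) (fun _ _ _ _ => erefl).

Definition scomp (X Y Z : sset) (g : smap Y Z) (f : smap X Y) : smap X Z.
Proof.
refine (@SMap X Z (fun n x => g n (f n x)) _).
by move=> m n a x; rewrite !snat.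
Defined.
Notation "g '∘s' f" := (scomp g f) (at level 40, left associativity).

Lemma scomp1s (X Y : sset) (f : smap X Y) : sid Y ∘s f = f.
Proof. exact: smap_eq. Qed.

Lemma scomps1 (X Y : sset) (f : smap X Y) : f ∘s sid X = f.
Proof. exact: smap_eq. Qed.

Lemma scompA (X Y Z T : sset) (h : smap Z T) (g : smap Y Z) (f : smap X Y) :
  h ∘s (g ∘s f) = h ∘s g ∘s f.
Proof. exact: smap_eq. Qed.

Definition Delta (n : nat) : sset.
Proof.
refine (@SSet (fun m => ordmap m n) (fun m p a x => ord_comp x a) _ _).
- by move=> m x; exact: ordmap_eq.
- by move=> m p q g f x; exact: ordmap_eq.
Defined.

(* A simplex of [Delta n] lies in the horn when it lies in one of the faces
   opposite to a vertex i != k. *)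
Definition in_horn (n : nat) (k : 'I_n.+1) (m : nat) (x : ordmap m n) : Prop :=
  exists2 i : 'I_n.+1, i != k & forall j, x j != i.

Lemma in_horn_act n (k : 'I_n.+1) m p (a : ordmap m p) (x : ordmap p n) :
  in_horn k x -> in_horn k (ord_comp x a).
Proof. by case=> i ik hx; exists i => // j; exact: hx. Qed.

Definition horn (n : nat) (k : 'I_n.+1) : sset.
Proof.
refine (@SSet (fun m => {x : ordmap m n | in_horn k x})
  (fun m p a x => exist _ (ord_comp (sval x) a) (in_horn_act a (svalP x))) _ _).
- by move=> m [x hx]; apply: eq_exist; exact: ordmap_eq.
- by move=> m p q g f [x hx]; apply: eq_exist; exact: ordmap_eq.
Defined.

Definition horn_incl (n : nat) (k : 'I_n.+1) : smap (horn k) (Delta n) :=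
  @SMap (horn k) (Delta n) (fun _ x => sval x) (fun _ _ _ _ => erefl).

Definition is_quasicategory (X : sset) : Prop :=
  forall (n : nat) (k : 'I_n.+1), 0 < k < n ->
  forall h : smap (horn k) X, exists s : smap (Delta n) X, s ∘s horn_incl k = h.

Record qcat := QCat {
  qcat_sset :> sset;
  qcatP : is_quasicategory qcat_sset
}.

Definition sprod (X Y : sset) : sset.
Proof.
refine (@SSet (fun n => (X n * Y n)%type)
  (fun m n a p => (act a p.1, act a p.2)) _ _).
- by move=> n [x y]; rewrite !act_id.
- by move=> m n p g f [x y]; rewrite !act_comp.
Defined.

Definition sfst (X Y : sset) : smap (sprod X Y) X :=
  @SMap (sprod X Y) X (fun _ p => p.1) (fun _ _ _ _ => erefl).

Definition spair (Z X Y : sset) (f : smap Z X) (g : smap Z Y) :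
  smap Z (sprod X Y).
Proof.
refine (@SMap Z (sprod X Y) (fun n z => (f n z, g n z)) _).
by move=> m n a z; rewrite !snat.
Defined.

Definition sprod_map (X X' Y Y' : sset) (f : smap X X') (g : smap Y Y') :
  smap (sprod X Y) (sprod X' Y').
Proof.
refine (@SMap (sprod X Y) (sprod X' Y') (fun n p => (f n p.1, g n p.2)) _).
by move=> m n a p; rewrite !snat.
Defined.

Lemma pullback_act (X Y Z : sset) (f : smap X Z) (g : smap Y Z) m n
    (a : ordmap m n) (p : X n * Y n) :
  f n p.1 = g n p.2 -> f m (act a p.1) = g m (act a p.2).
Proof. by move=> e; rewrite !snat e. Qed.

Definition pullback (X Y Z : sset) (f : smap X Z) (g : smap Y Z) : sset.
Proof.
refine (@SSet (fun n => {p : X n * Y n | f n p.1 = g n p.2})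
  (fun m n a p => exist _ (act a (sval p).1, act a (sval p).2)
                    (pullback_act a (svalP p))) _ _).
- by move=> n [[x y] h]; apply: eq_exist; rewrite /= !act_id.
- by move=> m n p a b [[x y] h]; apply: eq_exist; rewrite /= !act_comp.
Defined.

Definition pullback_snd (X Y Z : sset) (f : smap X Z) (g : smap Y Z) :
    smap (pullback f g) Y :=
  @SMap (pullback f g) Y (fun _ p => (sval p).2) (fun _ _ _ _ => erefl).

Definition Delta_map (m n : nat) (a : ordmap m n) : smap (Delta m) (Delta n).
Proof.
refine (@SMap (Delta m) (Delta n) (fun p x => ord_comp a x) _).
by move=> p q b x; exact: ordmap_eq.
Defined.

(* [sexp Y X] is the internal hom Y^X, with n-simplices the maps
   X * Delta n -> Y. *)
Definition sexp (Y X : sset) : sset.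
Proof.
refine (@SSet (fun n => smap (sprod X (Delta n)) Y)
  (fun m n a s => s ∘s sprod_map (sid X) (Delta_map a)) _ _).
- by move=> n s; apply: smap_eq => m [x b] /=; congr (s _ (_, _)); apply: ordmap_eq.
- by move=> m n p g f s; apply: smap_eq => q [x b] /=; congr (s _ (_, _)); apply: ordmap_eq.
Defined.

Definition post (X Y Z : sset) (g : smap Y Z) : smap (sexp Y X) (sexp Z X).
Proof.
refine (@SMap (sexp Y X) (sexp Z X) (fun n s => g ∘s s) _).
by move=> m n a s; exact: smap_eq.
Defined.
Arguments post X {Y Z} g.

Definition pre (X Y Z : sset) (f : smap X Y) : smap (sexp Z Y) (sexp Z X).
Proof.
refine (@SMap (sexp Z Y) (sexp Z X)
  (fun n s => s ∘s sprod_map f (sid (Delta n))) _).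
by move=> m n a s; exact: smap_eq.
Defined.
Arguments pre {X Y} Z f.

Definition seval (X Y : sset) (x : X 0) : smap (sexp Y X) Y.
Proof.
refine (@SMap (sexp Y X) Y
  (fun n s => s n (act (ord_const n ord0) x, ord_id n)) _).
move=> m n a s /=; rewrite -snat /= -act_comp; congr (s _ (act _ _, _)).
all: exact: ordmap_eq.
Defined.
Arguments seval {X} Y x.

(* The vertex of Y^X corresponding to a map X -> Y. *)
Definition vtx (X Y : sset) (f : smap X Y) : sexp Y X 0 := f ∘s sfst X (Delta 0).

Lemma post_vtx (X Y Z : sset) (g : smap Y Z) (f : smap X Y) :
  post X g 0 (vtx f) = vtx (g ∘s f).
Proof. exact: smap_eq. Qed.

Lemma pre_vtx (X Y Z : sset) (g : smap Y Z) (f : smap X Y) :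
  pre Z f 0 (vtx g) = vtx (g ∘s f).
Proof. exact: smap_eq. Qed.

Definition src (X : sset) (e : X 1) : X 0 := act (ord_const 0 ord0) e.
Definition tgt (X : sset) (e : X 1) : X 0 := act (ord_const 0 ord_max) e.
Definition degen (X : sset) (x : X 0) : X 1 := act (ord_const 1 ord0) x.

Record edge (X : sset) (x y : X 0) := Edge {
  edge_simp :> X 1;
  edge_src : src edge_simp = x;
  edge_tgt : tgt edge_simp = y
}.

Definition edge01 (X : sset) (s : X 2) : X 1 :=
  act (@ord_edge 2 (inord 0) (inord 1) ltac:(by rewrite !inordK)) s.
Definition edge12 (X : sset) (s : X 2) : X 1 :=
  act (@ord_edge 2 (inord 1) (inord 2) ltac:(by rewrite !inordK)) s.
Definition edge02 (X : sset) (s : X 2) : X 1 :=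
  act (@ord_edge 2 (inord 0) (inord 2) ltac:(by rewrite !inordK)) s.

(* [ho X] below is the category presented by the edges of [X], subject to the
   relations given by degenerate edges and by 2-simplices: its morphisms are
   the formal composites [word] modulo the least congruence [weq]. *)
Inductive word (X : sset) : X 0 -> X 0 -> Type :=
| wid (x : X 0) : word x x
| wedge (x y : X 0) (e : edge x y) : word x y
| wcomp (x y z : X 0) (q : word y z) (p : word x y) : word x z.

Inductive weq (X : sset) : forall x y : X 0, word x y -> word x y -> Prop :=
| weq_refl x y (p : word x y) : weq p p
| weq_sym x y (p q : word x y) : weq p q -> weq q p
| weq_trans x y (p q r : word x y) : weq p q -> weq q r -> weq p r
| weq_comp x y z (q q' : word y z) (p p' : word x y) :
    weq q q' -> weq p p' -> weq (wcomp q p) (wcomp q' p')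
| weq_1m x y (p : word x y) : weq (wcomp (wid y) p) p
| weq_m1 x y (p : word x y) : weq (wcomp p (wid x)) p
| weq_A x y z t (r : word z t) (q : word y z) (p : word x y) :
    weq (wcomp r (wcomp q p)) (wcomp (wcomp r q) p)
| weq_degen x (e : edge x x) :
    edge_simp e = degen x -> weq (wedge e) (wid x)
| weq_simplex x y z (f : edge x y) (g : edge y z) (k : edge x z) (s : X 2) :
    edge01 s = f -> edge12 s = g -> edge02 s = k ->
    weq (wcomp (wedge g) (wedge f)) (wedge k).

Section HoHom.
Variables (X : sset) (x y : X 0).

Definition weqb : rel {classic word x y} := fun p q => `[< weq p q >].

Lemma weqb_refl : reflexive weqb.
Proof. by move=> p; apply/asboolP; exact: weq_refl. Qed.

Lemma weqb_sym : symmetric weqb.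
Proof. by move=> p q; apply/asboolP/asboolP => /weq_sym. Qed.

Lemma weqb_trans : transitive weqb.
Proof.
by move=> q p r /asboolP pq /asboolP qr; apply/asboolP; exact: weq_trans qr.
Qed.

Canonical weq_equiv := EquivRel weqb weqb_refl weqb_sym weqb_trans.

Definition ho_hom : Type := {eq_quot weq_equiv}%qT.

Definition wclass (p : word x y) : ho_hom :=
  (\pi_({eq_quot weq_equiv}) (p : {classic word x y}))%qT.

Definition wrepr (f : ho_hom) : word x y := repr (f : {eq_quot weq_equiv}%qT).

Lemma wreprK (f : ho_hom) : wclass (wrepr f) = f.
Proof. exact: (@reprK _ {eq_quot weq_equiv}%qT). Qed.

Lemma wclassP (p q : word x y) : wclass p = wclass q <-> weq p q.
Proof.
split=> [/eqmodP /asboolP//|pq].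
by apply/eqmodP; apply/asboolP.
Qed.

End HoHom.

Lemma weq_repr (X : sset) (x y : X 0) (p : word x y) : weq (wrepr (wclass p)) p.
Proof. by apply/wclassP; exact: wreprK. Qed.

Definition ho (X : sset) : category.
Proof.
refine (@Category (X 0) (@ho_hom X) (fun x => wclass (wid x))
  (fun x y z g f => wclass (wcomp (wrepr g) (wrepr f))) _ _ _).
- move=> x y f; rewrite -[RHS]wreprK; apply/wclassP.
  apply: weq_trans (weq_1m _); apply: weq_comp (weq_refl _).
  exact: weq_repr.
- move=> x y f; rewrite -[RHS]wreprK; apply/wclassP.
  apply: weq_trans (weq_m1 _); apply: weq_comp (weq_refl _) _.
  exact: weq_repr.
- move=> x y z t h g f; apply/wclassP.
  apply: weq_trans (weq_comp (weq_refl _) (weq_repr _)) _.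
  apply: weq_trans (weq_A _ _ _) _.
  by apply: weq_comp (weq_refl _); apply: weq_sym; exact: weq_repr.
Defined.

Lemma wclassM (X : sset) (x y z : X 0) (q : word y z) (p : word x y) :
  wclass (wcomp q p) = (wclass q : @hom (ho X) y z) ∘m (wclass p : @hom (ho X) x y).
Proof.
by apply/wclassP; apply: weq_comp; apply: weq_sym; exact: weq_repr.
Qed.

Definition ho_edge (X : sset) (x y : X 0) (e : edge x y) : @hom (ho X) x y :=
  wclass (wedge e).

Section HoMap.
Variables (X Y : sset) (f : smap X Y).

Definition edge_map (x y : X 0) (e : edge x y) : edge (f 0 x) (f 0 y).
Proof.
refine (@Edge Y _ _ (f 1 e) _ _).
- by rewrite /src -snat; congr (f 0 _); exact: edge_src.
- by rewrite /tgt -snat; congr (f 0 _); exact: edge_tgt.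
Defined.

Fixpoint word_map (x y : X 0) (p : word x y) : word (f 0 x) (f 0 y) :=
  match p with
  | wid x => wid (f 0 x)
  | wedge _ _ e => wedge (edge_map e)
  | wcomp _ _ _ q p => wcomp (word_map q) (word_map p)
  end.

Lemma word_map_weq (x y : X 0) (p q : word x y) :
  weq p q -> weq (word_map p) (word_map q).
Proof.
elim=> {x y p q} /=.
- by move=> x y p; exact: weq_refl.
- by move=> x y p q _; exact: weq_sym.
- by move=> x y p q r _ + _; exact: weq_trans.
- by move=> x y z q q' p p' _ + _; exact: weq_comp.
- by move=> x y p; exact: weq_1m.
- by move=> x y p; exact: weq_m1.
- by move=> x y z t r q p; exact: weq_A.
- by move=> x e he; apply: weq_degen; rewrite /= he /degen snat.
- move=> x y z a b c s ha hb hc.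
  by apply: (@weq_simplex _ _ _ _ _ _ _ (f 2 s)); 
    rewrite /= -?ha -?hb -?hc /edge01 /edge12 /edge02 snat.
Qed.

Definition ho_map : functor (ho X) (ho Y).
Proof.
refine (@Functor (ho X) (ho Y) (f 0)
  (fun x y a => wclass (word_map (wrepr a))) _ _).
- by move=> x; apply/wclassP; apply: (word_map_weq (weq_repr _)).
- move=> x y z b a; rewrite -wclassM; apply/wclassP.
  exact: (word_map_weq (weq_repr _)).
Defined.

End HoMap.


(* [ho] is left adjoint to [nerve]: [ho_left_adjoint_nerve] is the universal
   property of the unit, and [ho_map_unit] identifies the action on maps. *)

Definition ordcat (n : nat) : category.
Proof.
refine (@Category 'I_n.+1 (fun i j => i <= j) (fun i => leqnn i)
  (fun i j k jk ij => leq_trans ij jk) _ _ _).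
all: by move=> *; exact: bool_irrelevance.
Defined.

Definition ordcat_map m n (a : ordmap m n) : functor (ordcat m) (ordcat n).
Proof.
refine (@Functor (ordcat m) (ordcat n) a (fun i j h => omap_homo a h) _ _).
all: by move=> *; exact: bool_irrelevance.
Defined.

Definition nerve (C : category) : sset.
Proof.
refine (@SSet (fun n => functor (ordcat n) C)
  (fun m n a x => functor_comp x (ordcat_map a)) _ _).
- move=> n x.
  apply: (@functor_eq _ _ (functor_comp x (ordcat_map (ord_id n))) x (fun=> erefl)).
  move=> i j h /=.
  by congr fmap; exact: bool_irrelevance.
- move=> m n p g f x.
  apply: (@functor_eq _ _ (functor_comp x (ordcat_map (ord_comp g f)))
    (functor_comp (functor_comp x (ordcat_map g)) (ordcat_map f)) (fun=> erefl)).
  move=> i j h /=.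
  by congr fmap; exact: bool_irrelevance.
Defined.

Definition nerve_map (C D : category) (F : functor C D) :
  smap (nerve C) (nerve D).
Proof.
refine (@SMap (nerve C) (nerve D) (fun n x => functor_comp F x) _).
move=> m n a x.
exact: (@functor_eq _ _ (functor_comp F (functor_comp x (ordcat_map a)))
  (functor_comp (functor_comp F x) (ordcat_map a)) (fun=> erefl)).
Defined.

Section Unit.
Variable X : sset.

Definition simp_vertex n (x : X n) (i : 'I_n.+1) : X 0 := act (ord_const 0 i) x.

Definition simp_edge n (x : X n) (i j : 'I_n.+1) (ij : i <= j) :
  edge (simp_vertex x i) (simp_vertex x j).
Proof.
refine (@Edge X _ _ (act (ord_edge ij) x) _ _).
- by rewrite /src -act_comp; congr act; apply: ordmap_eq.
- by rewrite /tgt -act_comp; congr act; apply: ordmap_eq.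
Defined.

Definition ord_triangle_fun n (i j k : 'I_n.+1) (l : 'I_3) : 'I_n.+1 :=
  match val l with 0 => i | 1 => j | _ => k end.

Lemma ord_triangle_homo n (i j k : 'I_n.+1) : i <= j -> j <= k ->
  {homo ord_triangle_fun i j k : a b / a <= b}.
Proof.
move=> ij jk; have ik := leq_trans ij jk.
by move=> [[|[|[|a]]] //= ha] [[|[|[|b]]] //= hb].
Qed.

Definition unit_simplex n (x : X n) : functor (ordcat n) (ho X).
Proof.
refine (@Functor (ordcat n) (ho X) (simp_vertex x)
  (fun i j ij => ho_edge (simp_edge x ij)) _ _).
- move=> i; apply/wclassP; apply: weq_degen.
  by rewrite /= /degen /simp_vertex -act_comp; congr act; apply: ordmap_eq => l;
     rewrite /= /ord_edge_fun; case: ifP.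
- move=> i j k jk ij; rewrite -wclassM; apply/wclassP; apply: weq_sym.
  apply: (@weq_simplex _ _ _ _ _ _ _ (act (OrdMap (ord_triangle_homo ij jk)) x)).
  all: rewrite /= /edge01 /edge12 /edge02 -act_comp; congr act; apply: ordmap_eq.
  all: by move=> [[|[|l]] hl] //; rewrite /= /ord_triangle_fun /ord_edge_fun /= inordK.
Defined.

Lemma edge_eq (x y : X 0) (e e' : edge x y) : e = e' :> X 1 -> e = e'.
Proof.
case: e e' => [e s t] [e' s' t'] /= h; case: _ / h s' t' => s' t'.
by congr Edge; exact: Prop_irrelevance.
Qed.

Lemma castm_ho_edge (x x' y y' : X 0) (ex : x = x') (ey : y = y')
    (e : edge x y) (e' : edge x' y') : e = e' :> X 1 ->
  @castm (ho X) _ _ _ _ ex ey (ho_edge e) = ho_edge e'.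
Proof. by case: _ / ex e'; case: _ / ey => e' h /=; congr ho_edge; exact: edge_eq. Qed.

Lemma simp_vertex_act m n (a : ordmap m n) (x : X n) (i : 'I_m.+1) :
  simp_vertex (act a x) i = simp_vertex x (a i).
Proof. by rewrite /simp_vertex -act_comp; congr act; apply: ordmap_eq. Qed.

Definition ho_unit : smap X (nerve (ho X)).
Proof.
refine (@SMap X (nerve (ho X)) unit_simplex _).
move=> m n a x.
apply: (@functor_eq _ _ (unit_simplex (act a x))
  (functor_comp (unit_simplex x) (ordcat_map a)) (simp_vertex_act a x)).
move=> i j ij; apply: castm_ho_edge; rewrite /= -act_comp; congr act.
by apply: ordmap_eq => k; rewrite /= /ord_edge_fun; case: ifP.
Defined.

End Unit.

Lemma castm_irr (C : category) (x x' y y' : C) (ex ex2 : x = x') (ey ey2 : y = y')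
    (f : hom x y) : castm ex ey f = castm ex2 ey2 f.
Proof. by rewrite (Prop_irrelevance ex ex2) (Prop_irrelevance ey ey2). Qed.

Lemma castm_id (C : category) (x y : C) (ex : x = x) (ey : y = y) (f : hom x y) :
  castm ex ey f = f.
Proof. exact: (castm_irr ex erefl ey erefl). Qed.

Lemma castm_idm (C : category) (x y : C) (e e' : x = y) :
  castm e e' (idm x) = idm y.
Proof. by case: _ / e e' => e'; rewrite castm_id. Qed.

Lemma castm_comp (C : category) (x x' y y' z z' : C) (ex : x = x') (ey : y = y')
    (ez : z = z') (g : hom y z) (f : hom x y) :
  castm ex ez (g ∘m f) = castm ey ez g ∘m castm ex ey f.
Proof. by case: _ / ex; case: _ / ey; case: _ / ez. Qed.

Lemma castm_castm (C : category) (x x' x'' y y' y'' : C) (ex : x = x')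
    (ex' : x' = x'') (ey : y = y') (ey' : y' = y'') (f : hom x y) :
  castm ex' ey' (castm ex ey f) = castm (etrans ex ex') (etrans ey ey') f.
Proof. by case: _ / ex'; case: _ / ey'. Qed.

Lemma fmap_castm (C D : category) (F G : functor C D) (x y : C) (f : hom x y)
    (ex : F x = G x) (ey : F y = G y) :
  F = G -> castm ex ey (fmap F f) = fmap G f.
Proof. by move=> e; case: _ / e ex ey => ex ey; rewrite castm_id. Qed.

Section Adjunct.
Variables (X : sset) (C : category) (F : smap X (nerve C)).

Definition adj_ob (x : X 0) : C := (F 0 x : functor _ _) ord0.

Lemma adj_obE n (x : X n) (i : 'I_n.+1) :
  (F n x : functor _ _) i = adj_ob (simp_vertex x i).
Proof. by rewrite /adj_ob /simp_vertex snat. Qed.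

Lemma adj_src (x y : X 0) (e : edge x y) :
  (F 1 e : functor _ _) ord0 = adj_ob x.
Proof. by rewrite adj_obE -[in RHS](edge_src e). Qed.

Lemma adj_tgt (x y : X 0) (e : edge x y) :
  (F 1 e : functor _ _) ord_max = adj_ob y.
Proof. by rewrite adj_obE -[in RHS](edge_tgt e). Qed.

Definition adj_edge (x y : X 0) (e : edge x y) : hom (adj_ob x) (adj_ob y) :=
  castm (adj_src e) (adj_tgt e)
    (@fmap (ordcat 1) C (F 1 e) ord0 ord_max (leq0n _)).

Lemma adj_edgeE n (s : X n) (i j : 'I_n.+1) (ij : i <= j) (x y : X 0)
    (e : edge x y) (ex : (F n s : functor _ _) i = adj_ob x)
    (ey : (F n s : functor _ _) j = adj_ob y) :
  e = act (ord_edge ij) s :> X 1 ->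
  adj_edge e = castm ex ey (@fmap (ordcat n) C (F n s) i j ij).
Proof.
move=> he; rewrite /adj_edge.
have h : F 1 e = functor_comp (F n s : functor _ _) (ordcat_map (ord_edge ij)).
  by rewrite he snat.
have E := @fmap_castm (ordcat 1) C _ _ ord0 ord_max (leq0n _) (congr1 (fun G : functor (ordcat 1) C => G ord0) h)
  (congr1 (fun G : functor (ordcat 1) C => G ord_max) h) h.
move: (adj_src e) (adj_tgt e) => p q.
have -> : castm ex ey (@fmap (ordcat n) C (F n s) i j ij) =
  castm ex ey (@fmap (ordcat 1) C
    (functor_comp (F n s : functor _ _) (ordcat_map (ord_edge ij))) ord0 ord_max (leq0n _)).
  by congr castm; rewrite /=; congr fmap; exact: bool_irrelevance.
by rewrite -E castm_castm; exact: castm_irr.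
Qed.

Fixpoint adj_word (x y : X 0) (p : word x y) : hom (adj_ob x) (adj_ob y) :=
  match p with
  | wid x => idm (adj_ob x)
  | wedge _ _ e => adj_edge e
  | wcomp _ _ _ q p => adj_word q ∘m adj_word p
  end.

Lemma adj_word_weq (x y : X 0) (p q : word x y) :
  weq p q -> adj_word p = adj_word q.
Proof.
elim=> {x y p q} /=.
- by [].
- by [].
- by move=> x y p q r _ -> _ ->.
- by move=> x y z q q' p p' _ -> _ ->.
- by move=> x y p; rewrite comp1m.
- by move=> x y p; rewrite compm1.
- by move=> x y z t r q p; rewrite compA.
- move=> x e he.
  rewrite (@adj_edgeE 0 x ord0 ord0 (leqnn _) _ _ e erefl erefl) /=.
    by rewrite -[RHS](@fmap1 (ordcat 0)); congr fmap; exact: bool_irrelevance.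
  rewrite he /degen; congr act; apply: ordmap_eq => k.
  by rewrite /= /ord_edge_fun; case: ifP.
- move=> x y z f g k s hf hg hk.
  have ex : (F 2 s : functor _ _) (inord 0) = adj_ob x.
    rewrite adj_obE -(edge_src f) -hf; congr adj_ob.
    by rewrite /src /edge01 -act_comp; congr act; apply: ordmap_eq.
  have ey : (F 2 s : functor _ _) (inord 1) = adj_ob y.
    rewrite adj_obE -(edge_tgt f) -hf; congr adj_ob.
    by rewrite /tgt /edge01 -act_comp; congr act; apply: ordmap_eq.
  have ez : (F 2 s : functor _ _) (inord 2) = adj_ob z.
    rewrite adj_obE -(edge_tgt g) -hg; congr adj_ob.
    by rewrite /tgt /edge12 -act_comp; congr act; apply: ordmap_eq.
  rewrite (adj_edgeE ey ez (esym hg)) (adj_edgeE ex ey (esym hf)).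
  rewrite (adj_edgeE ex ez (esym hk)) -castm_comp; congr castm.
  rewrite -(@fmapM (ordcat 2)); congr fmap; exact: bool_irrelevance.
Qed.

Definition adjunct : functor (ho X) C.
Proof.
refine (@Functor (ho X) C adj_ob (fun x y f => adj_word (wrepr f)) _ _).
- by move=> x; rewrite (adj_word_weq (weq_repr _)).
- by move=> x y z g f; rewrite (adj_word_weq (weq_repr _)).
Defined.

Lemma adjunctK : nerve_map adjunct ∘s ho_unit X = F.
Proof.
apply: smap_eq => n x.
apply: (@functor_eq _ _ (functor_comp adjunct (unit_simplex x)) (F n x)
  (fun i => esym (adj_obE x i))) => i j ij /=.
rewrite (adj_word_weq (weq_repr _)) /=.
rewrite (@adj_edgeE n x i j ij _ _ (simp_edge x ij) (adj_obE x i) (adj_obE x j) erefl).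
by rewrite castm_castm castm_id.
Qed.

End Adjunct.

Lemma simp_vertex0 (X : sset) (x : X 0) : simp_vertex x ord0 = x.
Proof.
rewrite -[RHS]act_id; congr act; apply: ordmap_eq => i.
by rewrite /= [i]ord1.
Qed.

Lemma ho_unit_inj (X : sset) (C : category) (G H : functor (ho X) C) :
  nerve_map G ∘s ho_unit X = nerve_map H ∘s ho_unit X -> G = H.
Proof.
move=> e.
have e' n (x : X n) : functor_comp G (unit_simplex x) =
    functor_comp H (unit_simplex x).
  exact: (congr1 (fun f : smap _ _ => f n x) e).
have eob x : G x = H x.
  by have /(congr1 (fun F : functor (ordcat 0) C => F ord0)) /= := e' 0 x; rewrite simp_vertex0.
apply: (functor_eq (eob := eob)) => x y f.
rewrite -[f]wreprK; elim: {f} (wrepr f) => {x y} [x|x y d|x y z q IHq p IHp].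
- have -> : wclass (wid x) = @idm (ho X) x by [].
  by rewrite !fmap1 castm_idm.
- case: d => d hs ht; case: _ / hs; case: _ / ht.
  have -> : Edge (erefl (src d)) (erefl (tgt d)) =
      @simp_edge X 1 d ord0 ord_max (leq0n _).
    apply: edge_eq; rewrite /= -[LHS]act_id; congr act; apply: ordmap_eq => k.
    by apply: val_inj; rewrite /= /ord_edge_fun; case: k => [[|[|k]] hk].
  exact: (@fmap_castm (ordcat 1) C (functor_comp G (unit_simplex d))
    (functor_comp H (unit_simplex d)) ord0 ord_max (leq0n _) (eob (src d)) (eob (tgt d)) (e' 1 d)).
- by rewrite wclassM !fmapM (castm_comp _ (eob y)) IHq IHp.
Qed.

Theorem ho_left_adjoint_nerve (X : sset) (C : category) (F : smap X (nerve C)) :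
  exists! G : functor (ho X) C, nerve_map G ∘s ho_unit X = F.
Proof.
exists (adjunct F); split; first exact: adjunctK.
by move=> G hG; apply: ho_unit_inj; rewrite adjunctK.
Qed.

Lemma ho_map_unit (X Y : sset) (f : smap X Y) :
  nerve_map (ho_map f) ∘s ho_unit X = ho_unit Y ∘s f.
Proof.
apply: smap_eq => n x.
apply: (@functor_eq _ _ (functor_comp (ho_map f) (unit_simplex x))
  (unit_simplex (f n x)) (fun i => snat f (ord_const 0 i) x)) => i j ij /=.
have -> : wclass (word_map f (wrepr (ho_edge (simp_edge x ij)))) =
    ho_edge (edge_map f (simp_edge x ij)).
  by apply/wclassP; exact: (word_map_weq f (weq_repr _)).
by apply: castm_ho_edge; rewrite /= snat.
Qed.

(* The hom-category hom'(A, B) = h(B^A). *)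
Definition hom2 (A B : sset) : category := ho (sexp B A).

Definition twocell (A B : sset) (f g : smap A B) : Type :=
  @hom (hom2 A B) (vtx f) (vtx g).

Definition twocell_id (A B : sset) (f : smap A B) : twocell f f :=
  @idm (hom2 A B) (vtx f).

Definition twocell_comp (A B : sset) (f g h : smap A B)
    (b : twocell g h) (a : twocell f g) : twocell f h :=
  @comp (hom2 A B) _ _ _ b a.

Definition twocell_of_eq (A B : sset) (f g : smap A B) (e : f = g) :
    twocell f g :=
  @castm (hom2 A B) _ _ _ _ (erefl (vtx f)) (congr1 (@vtx A B) e) (twocell_id f).

(* Horizontal composition with an identity 2-cell is the functor h applied to
   post- and precomposition, B^A -> C^A and C^B -> C^A; the casts come from the
   encoding of 1-cells as vertices of the internal homs. *)
Definition whisker_l (A B C : sset) (g : smap B C) (f f' : smap A B)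
    (a : twocell f f') : twocell (g ∘s f) (g ∘s f') :=
  @castm (hom2 A C) _ _ _ _ (post_vtx g f) (post_vtx g f')
    (fmap (ho_map (post A g)) a).

Definition whisker_r (A B C : sset) (g g' : smap B C) (a : twocell g g')
    (f : smap A B) : twocell (g ∘s f) (g' ∘s f) :=
  @castm (hom2 A C) _ _ _ _ (pre_vtx g f) (pre_vtx g' f)
    (fmap (ho_map (pre C f)) a).

Notation "b '•' a" := (twocell_comp b a) (at level 50, left associativity).

(* The strict unit and associativity laws of 1-cells are only propositional
   equalities, whence the identity 2-cells [twocell_of_eq] in the triangle
   identities (epsilon f)(f eta) = id and (u epsilon)(eta u) = id. *)
Record adjunction (A B : qcat) (f : smap B A) (u : smap A B) := Adjunction {
  adj_unit : twocell (sid B) (u ∘s f);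
  adj_counit : twocell (f ∘s u) (sid A);
  adj_triangle_l :
    twocell_of_eq (scomp1s f) • whisker_r adj_counit f
      • twocell_of_eq (scompA f u f)
      • whisker_l f adj_unit • twocell_of_eq (esym (scomps1 f))
    = twocell_id f;
  adj_triangle_r :
    twocell_of_eq (scomps1 u) • whisker_l u adj_counit
      • twocell_of_eq (esym (scompA u f u))
      • whisker_r adj_unit u • twocell_of_eq (esym (scomp1s u))
    = twocell_id u
}.

Definition sdom (A : sset) : smap (sexp A (Delta 1)) A :=
  @seval (Delta 1) A (ord_const 0 ord0).
Definition scod (A : sset) : smap (sexp A (Delta 1)) A :=
  @seval (Delta 1) A (ord_const 0 ord_max).

(* For f : B -> A and g : C -> A, the comma object f ↓ g with its projection
   (p_1, p_0) to C * B: the pullback of (cod, dom) : A^(Delta 1) -> A * A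
   along g * f : C * B -> A * A. *)
Definition comma (A B C : sset) (f : smap B A) (g : smap C A) : sset :=
  pullback (spair (scod A) (sdom A)) (sprod_map g f).

Definition comma_proj (A B C : sset) (f : smap B A) (g : smap C A) :
    smap (comma f g) (sprod C B) :=
  pullback_snd (spair (scod A) (sdom A)) (sprod_map g f).

Definition iso_edge (X : sset) (x y : X 0) (e : edge x y) : Prop :=
  iso_mor (ho_edge e).

Definition is_degenerate1 (X : sset) (e : X 1) : Prop :=
  exists x : X 0, e = degen x.

(* Meant for isofibrations p and q of quasi-categories. *)
Definition fibred_equivalence (E F Q : sset) (p : smap E Q) (q : smap F Q)
    (w : smap E F) : Prop :=
  q ∘s w = p /\
  exists w' : smap F E,
    [/\ p ∘s w' = q,
        exists a : edge (vtx (w' ∘s w)) (vtx (sid E)),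
          iso_edge a /\ is_degenerate1 (post E p 1 a)
      & exists b : edge (vtx (sid F)) (vtx (w ∘s w')),
          iso_edge b /\ is_degenerate1 (post F q 1 b)].

(* Main.v *)
(* The transpose of the tautological edge [psi : f p0 -> p1] is a composite
   [u psi * eta p0], which classifies a map [w : f ↓ A -> B ↓ u] over [A * B];
   dually [eps q1 * f phi] classifies [w'].  Interchange and the triangle
   identities make the edges classified by [w' w] and [id] homotopic in
   [A^(f ↓ A)].  Such a homotopy is an edge over [A * B] from [w' w] to [id],
   and it is invertible because every edge of a mapping space
   presented by simplices with the face opposite to the last vertex degenerate
   has a right inverse, obtained from an inner horn of dimension 3.  Calculating with edges requires that [A^X] is
   a quasi-category: the inner horn of [Delta n] is a retract of the
   pushout-product of its inclusion with that of the inner horn of [Delta 2],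
   which reduces the claim to attaching the maximal chains of [m] * [2] one by
   one along inner horns.  Equal morphisms of the homotopy category come from
   homotopic edges by evaluating words of edges up to homotopy. *)
From mathcomp Require Import all_boot.
From mathcomp Require Import boolp zify.
Require Import Defs.

Set Implicit Arguments.
Unset Strict Implicit.
Unset Printing Implicit Defensive.

(** * Extending maps of subcomplexes *)

Definition spred (L : sset) := forall n, L n -> Prop.

Definition sfull (L : sset) : spred L := fun _ _ => True.

Definition natural_on (L A : sset) (S : spred L) (h : forall n, L n -> A n) :=
  forall m n (a : ordmap m n) (x : L n), S n x -> h m (act a x) = act a (h n x).

(* A map from a subcomplex [S] of [L] to [A] is encoded as a total function on
   [L] that is only required to be natural on [S]. *)
Definition extends (A L : sset) (S T : spred L) :=
  forall h : forall n, L n -> A n, natural_on S h ->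
  exists2 g : forall n, L n -> A n,
    natural_on T g & forall n (x : L n), S n x -> g n x = h n x.

Definition sclosed (L : sset) (S : spred L) :=
  forall m n (a : ordmap m n) (x : L n), S n x -> S m (act a x).

Lemma natural_onS (A L : sset) (S T : spred L) (h : forall n, L n -> A n) :
  (forall n (x : L n), S n x -> T n x) -> natural_on T h -> natural_on S h.
Proof. by move=> ST hT m n a x /ST; exact: hT. Qed.

Lemma extends_trans (A L : sset) (S T U : spred L) :
  (forall n (x : L n), S n x -> T n x) ->
  extends A S T -> extends A T U -> extends A S U.
Proof.
move=> ST eST eTU h /eST[g /eTU[k kU kg] gh]; exists k => // n x Sx.
by rewrite kg ?gh //; exact: ST.
Qed.

Lemma extends_weaken (A L : sset) (S S' T T' : spred L) :
  (forall n (x : L n), S n x <-> S' n x) ->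
  (forall n (x : L n), T' n x -> T n x) ->
  extends A S T -> extends A S' T'.
Proof.
move=> SS TT eST h hS'; have [g gT gh] := eST h (natural_onS (fun n x => proj1 (SS n x)) hS').
by exists g => [|n x /SS]; [exact: natural_onS gT|exact: gh].
Qed.

(** Cell attachment: outside [S] the maps [tau j] are injective with disjoint images, so a simplex
    of [T] not in [S] has unique coordinates [(j, d)] and its value can be prescribed cell by
    cell. *)
Lemma extends_glue (A L D : sset) (J : Type) (tau : J -> smap D L)
    (S T : spred L) :
  sclosed S ->
  (forall n (x : L n), T n x -> S n x \/ exists j d, x = tau j n d) ->
  (forall j j' n (d d' : D n), ~ S n (tau j n d) ->
     tau j n d = tau j' n d' -> j = j' /\ d = d') ->
  (forall j, extends A (fun n d => S n (tau j n d)) (@sfull D)) ->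
  extends A S T.
Proof.
move=> Scl Tcov tau_inj ext h hS.
have /choice[g gP] : forall j, exists g : forall n, D n -> A n,
    natural_on (@sfull D) g /\
    forall n d, S n (tau j n d) -> g n d = h n (tau j n d).
  move=> j; have [|g gD gh] := ext j (fun n d => h n (tau j n d)).
    by move=> m n a d Sd; rewrite snat hS.
  by exists g.
(* The last branch is a default value; it is never reached on [T], which is covered by [S] and the
   cells. *)
pose k n (x : L n) : A n :=
  match pselect (S n x) with
  | left _ => h n x
  | right _ => match pselect (exists jd : J * D n, x = tau jd.1 n jd.2) with
    | left ex => g (projT1 (cid ex)).1 n (projT1 (cid ex)).2
    | right _ => h n x
    end
  end.
have kS n (x : L n) : S n x -> k n x = h n x.
  by rewrite /k; case: pselect.
have ktau j n d : k n (tau j n d) = g j n d.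
  have [gD gh] := gP j.
  rewrite /k; case: pselect => [/gh//|nS]; case: pselect => [ex|[]]; last by exists (j, d).
  case: cid => -[j' d'] /= e.
  by have [<- <-] := tau_inj _ _ _ _ _ nS e.
exists k => // m n a x /Tcov[Sx|[j [d ->]]].
  by rewrite !kS ?hS //; exact: Scl.
by rewrite -snat !ktau (proj1 (gP j)).
Qed.

(** * Faces and degeneracies from functions on natural numbers *)

Lemma ord_clip_proof n i : minn i n < n.+1. Proof. lia. Qed.

Definition ord_clip m n (f : nat -> nat) (fP : {homo f : i j / i <= j}) : ordmap m n.
Proof.
refine (@OrdMap m n (fun i => Ordinal (ord_clip_proof n (f i))) _).
by move=> i j /fP /= h; lia.
Defined.

Lemma ord_clipE m n f (fP : {homo f : i j / i <= j}) (i : 'I_m.+1) :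
  ord_clip m n fP i = minn (f i) n :> nat.
Proof. by []. Qed.
Arguments ord_clipE {m} n {f} fP i.

Definition misses m n (x : ordmap m n) (v : nat) := forall j, x j != v :> nat.

Lemma in_hornP n (k : 'I_n.+1) m (x : ordmap m n) :
  in_horn k x <-> exists v : nat, [/\ v <= n, v != k & misses x v].
Proof.
split=> [[i ik xi]|[v [vn vk xv]]].
  by exists i; split=> //; rewrite -ltnS.
by exists (Ordinal (vn : v < n.+1)).
Qed.

Lemma hitP m n (x : ordmap m n) v : ~ misses x v -> exists j, x j = v :> nat.
Proof. by move/existsNP => [j /negP]; rewrite negbK => /eqP e; exists j. Qed.

Lemma extends_horn (A : qcat) n (k : 'I_n.+1) : 0 < k < n ->
  extends A (fun m (x : Delta n m) => in_horn k x) (@sfull (Delta n)).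
Proof.
move=> kn h hS.
have hnat m p (a : ordmap m p) (x : horn k p) :
    h m (sval (act a x)) = act a (h p (sval x)).
  by rewrite -hS //; exact: (svalP x).
have [s sh] := qcatP kn (SMap hnat).
exists (fun m x => s m x) => [m p a x _|m x xS]; first by rewrite snat.
exact: (congr1 (fun f : smap (horn k) A => f m (exist (fun y : ordmap m n => in_horn k y) x xS)) sh).
Qed.

Lemma bump_homo v : {homo bump v : i j / i <= j}.
Proof. by move=> i j; rewrite leq_bump2. Qed.

Lemma unbump_homo v : {homo unbump v : i j / i <= j}.
Proof. by move=> i j ij; rewrite /unbump; do 2![case: ltnP => /=]; lia. Qed.

Definition coface n (v : nat) : ordmap n n.+1 := ord_clip n n.+1 (@bump_homo v).
(** Clipping makes [codegen n n.+1] coincide with [codegen n n], so that every face map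
    [coface n v], including the last, has [codegen n v] as a retraction. *)
Definition codegen n (v : nat) : ordmap n.+1 n := ord_clip n.+1 n (@unbump_homo v).

Lemma cofaceE n v (i : 'I_n.+1) : coface n v i = bump v i :> nat.
Proof. by have := ltn_ord i; rewrite ord_clipE /bump; case: (leqP v i) => /=; lia. Qed.

Lemma codegenE n v (i : 'I_n.+2) : v <= n.+1 -> i != v :> nat ->
  codegen n v i = unbump v i :> nat.
Proof. by have := ltn_ord i; rewrite ord_clipE /unbump; case: (ltnP v i) => /=; lia. Qed.

(** [coface n v] after [codegen n v] moves only the vertex [v]; hence a simplex missing [v] factors
    through the face opposite to [v]. *)
Lemma coface_codegen m n v (x : ordmap m n.+1) : v <= n.+1 -> misses x v ->
  ord_comp (coface n v) (ord_comp (codegen n v) x) = x.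
Proof.
move=> vn xv; apply: ordmap_eq => j; apply: val_inj.
by rewrite [LHS]cofaceE codegenE // unbumpKcond (negbTE (xv j)).
Qed.

Lemma coface_inj m n v (x y : ordmap m n) :
  ord_comp (coface n v) x = ord_comp (coface n v) y -> x = y.
Proof.
move=> e; apply: ordmap_eq => j; apply: val_inj; apply: (can_inj (bumpK v)).
by rewrite -!cofaceE (congr1 (fun f : ordmap _ _ => f j : nat) e).
Qed.

(* For [k < l], the face opposite to [l] is attached along the inner horn at
   [k]; the result is the inner horn at [k]. *)
Lemma extends_horn2 (A : qcat) n (k l : nat) : 0 < k <= l -> l < n ->
  extends A (fun m (x : Delta n m) =>
     exists v, [/\ v <= n, v != k, v != l & misses x v]) (@sfull (Delta n)).
Proof.
move=> kl ln; have kn : k < n.+1 by lia.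
have hornk : extends A (fun m (x : Delta n m) => in_horn (Ordinal kn) x) (@sfull (Delta n)).
  by apply: extends_horn => /=; lia.
case: (eqVneq k l) => [e|nkl].
  apply: extends_weaken hornk => // m x; rewrite in_hornP -e /=.
  by split=> [[v [? ? ?]]|[v [? ? ? ?]]]; exists v.
apply: extends_trans hornk.
  by move=> m x [v [? ? _ ?]]; apply/in_hornP; exists v.
case: n ln kn => [|n] ln kn; first lia.
have kn' : k < n.+1 by lia.
apply: (@extends_glue A (Delta n.+1) (Delta n) unit (fun=> Delta_map (coface n l))).
- move=> m p a x [v [vn vk vl xv]]; exists v; split=> // j; exact: xv.
- move=> m x /in_hornP[v [/= vn vk xv]].
  case: (eqVneq v l) => [vl|vl]; last by left; exists v.
  right; exists tt, (ord_comp (codegen n l) x).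
  by rewrite /= coface_codegen // -vl.
- by move=> [] [] m d d' _ /coface_inj ->.
- move=> _.
  (* The face opposite to [l] meets the remaining faces in its own horn at [k]: as [k < l], the
     vertex [k] keeps its index, and it is still inner. *)
  apply: extends_weaken (@extends_horn A n (Ordinal kn') _) => //=; last lia.
  move=> m d; rewrite in_hornP; split=> [[v [vn /= vk dv]]|[v [vn vk vl dv]]].
    exists (bump l v); rewrite /bump in vk *; split; [lia|lia|lia|].
    by move=> j; rewrite cofaceE (inj_eq (can_inj (bumpK l))).
  exists (unbump l v); rewrite /unbump; split; [lia|rewrite /=; lia|].
  by move=> j; apply: contra (dv j) => /eqP e; rewrite cofaceE e unbumpKcond (negbTE vl).
Qed.

(** * Prisms *)

Section Prism.
Variables (A : qcat) (m : nat).
Local Notation L := (sprod (Delta m) (Delta 2)).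

(** The domain of the pushout-product of the boundary inclusion of [Delta m] with the inner horn
    inclusion of [Delta 2]. *)
Definition prism_bd : spred L := fun n x =>
  (exists2 v, v <= m & misses x.1 v) \/ (misses x.2 0 \/ misses x.2 2).

Definition stair_row (i j l : nat) : nat := (i < l) + (j.+1 < l).
Definition stair_col (i j l : nat) : nat := l - stair_row i j l.

Lemma stair_row_homo i j : {homo stair_row i j : k l / k <= l}.
Proof. by move=> k l; rewrite /stair_row; do 4![case: ltnP => ? /=]; lia. Qed.

Lemma stair_col_homo i j : i <= j -> {homo stair_col i j : k l / k <= l}.
Proof.
by move=> ij k l; rewrite /stair_col /stair_row; do 4![case: ltnP => ? /=]; lia.
Qed.

(* The maximal chain of [m] x [2] which passes to row 1 in column i and to
   row 2 in column j; the vertex in column c and row r has index c + r. *)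
Definition stair i j (ij : i <= j) : smap (Delta m.+2) L :=
  spair (Delta_map (ord_clip m.+2 m (stair_col_homo ij)))
        (Delta_map (ord_clip m.+2 2 (@stair_row_homo i j))).

Lemma stairE1 i j (ij : i <= j) n (d : Delta m.+2 n) q : j <= m ->
  (stair ij n d).1 q = stair_col i j (d q) :> nat.
Proof.
move=> jm; have dq := ltn_ord (d q).
apply: (etrans (ord_clipE m (stair_col_homo ij) (d q))).
by rewrite /stair_col /stair_row; do 2![case: ltnP => ? /=]; lia.
Qed.

Lemma stairE2 i j (ij : i <= j) n (d : Delta m.+2 n) q :
  (stair ij n d).2 q = stair_row i j (d q) :> nat.
Proof.
apply: (etrans (ord_clipE 2 (@stair_row_homo i j) (d q))).
by rewrite /stair_row; do 2![case: ltnP => ? /=]; lia.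
Qed.

Definition in_stair (i j : nat) : spred L := fun n x =>
  forall q, [/\ x.2 q = 0 :> nat -> x.1 q <= i,
    x.2 q = 1 :> nat -> i <= x.1 q <= j & x.2 q = 2 :> nat -> j <= x.1 q].

Lemma in_stairP i j (ij : i <= j) n (x : L n) : j <= m -> in_stair i j x ->
  exists d, x = stair ij n d.
Proof.
move=> jm xij.
have dP : {homo (fun q : 'I_n.+1 => inord (x.1 q + x.2 q) : 'I_m.+3) : k l / k <= l}.
  move=> k l /[dup] /(omap_homo x.1) h1 /(omap_homo x.2) h2.
  have ? := ltn_ord (x.1 l); have ? := ltn_ord (x.2 l).
  by rewrite !inordK; lia.
exists (OrdMap dP).
have dE q : OrdMap dP q = x.1 q + x.2 q :> nat.
  by have ? := ltn_ord (x.1 q); have ? := ltn_ord (x.2 q); apply: inordK; lia.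
have rE q : stair_row i j (x.1 q + x.2 q) = x.2 q.
  have [h0 h1 h2] := xij q; have := ltn_ord (x.2 q); move: h0 h1 h2.
  move: (x.2 q : nat) (x.1 q : nat) => r c.
  by rewrite /stair_row; case: r => [|[|[|r]]] h0 h1 h2 h3; do 2![case: ltnP => ? /=]; lia.
rewrite [LHS]surjective_pairing [RHS]surjective_pairing.
congr pair; apply: ordmap_eq => q; apply: val_inj.
  by rewrite [RHS]stairE1 // dE /stair_col rE addnK.
by rewrite [RHS]stairE2 dE rE.
Qed.

(** Chains are attached with [i] increasing and, for fixed [i], with [j] decreasing. In this order a
    new chain meets the earlier ones and the boundary in all faces except those opposite to [i.+1]
    and [j.+1]. *)
Definition prism_stage (i j : nat) : spred L := fun n x =>
  prism_bd x \/ exists i' j',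
    [/\ i' <= j', j' <= m, (i' < i) || (i' == i) && (j <= j') & in_stair i' j' x].

Lemma prism_stage_closed i j : sclosed (prism_stage i j).
Proof.
move=> n p a x [[[v vm xv]|[x0|x2]]|[i' [j' [? ? ? h]]]].
- by left; left; exists v => // q; exact: xv.
- by left; right; left => q; exact: x0.
- by left; right; right => q; exact: x2.
- by right; exists i', j'; split=> // q; exact: h.
Qed.

(** Omitting the vertex [i] leads into the chain [(i.-1, j)], or out of row 0 if [i = 0]; omitting
    [j.+2] leads into [(i, j.+1)], or out of row 2 if [j = m]. Omitting any other vertex apart from
    [i.+1] and [j.+1] empties a column. *)
Lemma prism_stage_stair i j (ij : i <= j) n (d : Delta m.+2 n) : j <= m ->
  prism_stage i j.+1 (stair ij n d) <->
  exists v, [/\ v <= m.+2, v != i.+1, v != j.+1 & misses d v].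
Proof.
move=> jm; split=> [Sd|[v [vm vi vj dv]]].
  apply: contrapT => nd.
  have hit v : v <= m.+2 -> v != i.+1 -> v != j.+1 -> exists q, d q = v :> nat.
    by move=> ? ? ?; apply: hitP => dv; apply: nd; exists v.
  case: Sd => [[[v vm xv]|[x0|x2]]|[i' [j' [i'j' j'm h xd]]]].
  (* Every column contains a vertex of the chain whose index is neither [i.+1] nor [j.+1], so no
     column is missed. *)
  - have [q qE] : exists q, d q = (if v <= i then v else if v < j then v.+1 else v.+2) :> nat.
      by apply: hit; case: (leqP v i); case: (leqP j v); lia.
    have := xv q; rewrite stairE1 // qE /stair_col /stair_row.
    by case: (leqP v i); case: (leqP j v) => ? ? /eqP[];
      do 2![case: ltnP => ? /=]; lia.
  - have [q qE] : exists q, d q = 0 :> nat by apply: hit.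
    by have := x0 q; rewrite stairE2 qE.
  - have [q qE] : exists q, d q = m.+2 :> nat by apply: hit; lia.
    by have := x2 q; rewrite stairE2 qE /stair_row => /eqP[]; do 2![case: ltnP => ? /=]; lia.
  - case/orP: h => [i'i|/andP[/eqP i'i jj']].
      have [q qE] : exists q, d q = i :> nat by apply: hit; lia.
      have [+ _ _] := xd q; rewrite stairE1 // stairE2 qE /stair_col /stair_row.
      by do 2![case: ltnP => ? /=]; lia.
    have [q qE] : exists q, d q = j.+2 :> nat by apply: hit; lia.
    have [_ _] := xd q; rewrite stairE1 // stairE2 qE /stair_col /stair_row.
    by do 2![case: ltnP => ? /=]; lia.
have colmiss c : c <= m -> (forall l, l != v -> l <= m.+2 -> stair_col i j l != c) ->
    prism_stage i j.+1 (stair ij n d).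
  move=> cm h; left; left; exists c => // q; rewrite stairE1 //.
  by apply: h; [exact: dv|have := ltn_ord (d q); lia].
have sub i' j' : i' <= j' -> j' <= m -> (i' < i) || (i' == i) && (j < j') ->
    (forall l, l != v -> [/\ stair_row i j l = 0 -> stair_col i j l <= i',
      stair_row i j l = 1 -> i' <= stair_col i j l <= j'
      & stair_row i j l = 2 -> j' <= stair_col i j l]) ->
    prism_stage i j.+1 (stair ij n d).
  move=> ? ? ? h; right; exists i', j'; split=> // q.
  by rewrite stairE1 // stairE2; apply: h; exact: dv.
case: (ltngtP v i) => [vlt|vgt|veq].
- apply: (colmiss v); first lia.
  by move=> l lv lm; rewrite /stair_col /stair_row; do 2![case: ltnP => ? /=]; lia.
- case: (ltngtP v j.+2) => [vlt|vgt'|veq].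
  + apply: (colmiss v.-1); first lia.
    by move=> l lv lm; rewrite /stair_col /stair_row; do 2![case: ltnP => ? /=]; lia.
  + apply: (colmiss v.-2); first lia.
    by move=> l lv lm; rewrite /stair_col /stair_row; do 2![case: ltnP => ? /=]; lia.
  + case: (ltngtP j m) => [jltm||jem]; [|lia|].
      apply: (sub i j.+1); [lia|lia|lia|move=> l lv].
      by rewrite /stair_col /stair_row; do 2![case: ltnP => ? /=]; split; lia.
    left; right; right => q; have := dv q; have := ltn_ord (d q).
    by rewrite stairE2 /stair_row; do 2![case: ltnP => ? /=]; lia.
- case: (posnP i) => [i0|ipos].
    left; right; left => q; have := dv q.
    by rewrite stairE2 /stair_row; do 2?[case: ltnP => ? /=]; lia.
  apply: (sub i.-1 j); [lia|lia|lia|move=> l lv].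
  by rewrite /stair_col /stair_row; do 2![case: ltnP => ? /=]; split; lia.
Qed.

Lemma extends_prism_step i j : i <= j <= m ->
  extends A (prism_stage i j.+1) (prism_stage i j).
Proof.
move=> /andP[ij jm].
apply: (@extends_glue A L (Delta m.+2) unit (fun=> stair ij)).
- exact: prism_stage_closed.
- move=> n x [Bx|[i' [j' [i'j' j'm h xij]]]]; first by left; left.
  case: (boolP ((i' == i) && (j' == j))) => [/andP[/eqP ei /eqP ej]|ne].
    right; exists tt; rewrite ei ej in xij; exact: in_stairP.
  by left; right; exists i', j'; split=> //; lia.
- move=> [] [] n d d' _ e; split=> //; apply: ordmap_eq => q; apply: val_inj => /=.
  have := congr1 (fun z : L n => (z.1 q : nat)) e.
  have := congr1 (fun z : L n => (z.2 q : nat)) e.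
  rewrite !stairE1 // !stairE2 /stair_col => ->.
  have b k : stair_row i j k <= k by rewrite /stair_row; do 2![case: ltnP => ? /=]; lia.
  have b' : stair_row i j (d q) <= stair_row i j (d' q).
    by have := congr1 (fun z : L n => (z.2 q : nat)) e; rewrite !stairE2 => ->.
  have := b (d q); have := b (d' q); have := congr1 (fun z : L n => (z.2 q : nat)) e.
  by rewrite !stairE2; lia.
- move=> _; apply: extends_weaken (@extends_horn2 A m.+2 i.+1 j.+1 _ _) => //; try lia.
  by move=> n d; split=> /(prism_stage_stair _ _ jm).
Qed.

(** With second index [m.+1] no chain of first index [i] is present; attaching [(i, m)] down to
    [(i, i)] reaches [prism_stage i i], which contains [prism_stage i.+1 m.+1]. *)
Lemma extends_prism_row i : i <= m ->
  extends A (prism_stage i m.+1) (prism_stage i.+1 m.+1).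
Proof.
move=> im.
have mono j j' n (x : L n) : j' <= j -> prism_stage i j x -> prism_stage i j' x.
  move=> j'j; case=> [|[i1 [j1 [? ? ? ?]]]]; first by left.
  by right; exists i1, j1; split=> //; lia.
have step k : k <= m.+1 - i -> extends A (prism_stage i m.+1) (prism_stage i (m.+1 - k)).
  elim: k => [_|k IHk km]; first by rewrite subn0 => h ?; exists h.
  apply: extends_trans (IHk _) _; last 2 first.
  - lia.
  - have -> : m.+1 - k = (m.+1 - k.+1).+1 by lia.
    by apply: extends_prism_step; lia.
  by move=> n x; apply: mono; lia.
apply: extends_weaken (step (m.+1 - i) _) => // n x.
rewrite subKn; last lia.
case=> [|[i' [j' [? ? ? ?]]]]; first by left.
by right; exists i', j'; split=> //; lia.
Qed.

(** A simplex meeting rows 0 and 2 lies in the chain where [i] is its largest column in row 0 and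
    [j] its least column in row 2. *)
Lemma prism_stage_last n (x : L n) : prism_stage m.+1 m.+1 x.
Proof.
apply: contrapT => nx.
have [x0 x2] : (exists q, x.2 q = 0 :> nat) /\ (exists q, x.2 q = 2 :> nat).
  by split; apply: hitP => h; apply: nx; left; right; [left|right].
have ex0 : exists c, [exists q, (x.2 q == 0 :> nat) && (x.1 q == c :> nat)].
  by have [q qE] := x0; exists (x.1 q); apply/existsP; exists q; rewrite qE !eqxx.
have ex2 : exists c, [exists q, (x.2 q == 2 :> nat) && (x.1 q == c :> nat)].
  by have [q qE] := x2; exists (x.1 q); apply/existsP; exists q; rewrite qE !eqxx.
have ub0 c : [exists q, (x.2 q == 0 :> nat) && (x.1 q == c :> nat)] -> c <= m.
  by move=> /existsP[q /andP[_ /eqP <-]]; rewrite -ltnS.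
have mono q q' : x.2 q < x.2 q' -> x.1 q <= x.1 q'.
  move=> h; apply: (omap_homo x.1).
  by case: (leqP q q') => // /ltnW /(omap_homo x.2); rewrite leqNgt h.
case: (ex_maxnP ex0 ub0) => i /existsP[q0 /andP[/eqP r0 /eqP c0]] imax.
case: (ex_minnP ex2) => j /existsP[q2 /andP[/eqP r2 /eqP c2]] jmin.
apply: nx; right; exists i, j; split.
- by rewrite -c0 -c2; apply: mono; rewrite r0 r2.
- by rewrite -c2 -ltnS.
- by rewrite -c0 ltn_ord.
- move=> q; split=> r.
  + by apply: imax; apply/existsP; exists q; rewrite r !eqxx.
  + by rewrite -c0 -c2 !mono // ?r0 ?r2 r.
  + by apply: jmin; apply/existsP; exists q; rewrite r !eqxx.
Qed.

Lemma extends_prism : extends A prism_bd (@sfull L).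
Proof.
have row i : i <= m.+1 -> extends A (prism_stage 0 m.+1) (prism_stage i m.+1).
  elim: i => [_|i IHi im]; first by move=> h; exists h.
  apply: extends_trans (IHi _) (extends_prism_row _); try lia.
  move=> n x [|[i' [j' [? ? ? ?]]]]; [by left|lia].
apply: extends_weaken (row m.+1 (leqnn _)) => n x; last first.
  by move=> _; exact: prism_stage_last.
split=> [[//|[i' [j' [? ? ? ?]]]]|]; [lia|by left].
Qed.

End Prism.

(** * Exponentials of quasi-categories *)

Definition yoneda (X : sset) n (x : X n) : smap (Delta n) X :=
  @SMap (Delta n) X (fun m a => act a x) (fun _ _ b a => act_comp a b x).

(** Each chosen extension agrees with the previous one on its domain, so the value at a simplex may
    be read off at any stage containing it. *)
Lemma extends_union (A L : sset) (S : nat -> spred L) :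
  (forall m n (x : L n), S m n x -> S m.+1 n x) ->
  (forall n (x : L n), exists m, S m n x) ->
  (forall m, extends A (S m) (S m.+1)) -> extends A (S 0) (@sfull L).
Proof.
move=> SS Sall ext h h0.
pose next m (k : {k : forall n, L n -> A n | natural_on (S m) k}) :
    {k' : forall n, L n -> A n | natural_on (S m.+1) k'} :=
  let e := cid2 (ext m _ (svalP k)) in exist (fun k' => natural_on (S m.+1) k') (s2val e) (s2valP e).
pose F := nat_rect (fun m => {k : forall n, L n -> A n | natural_on (S m) k})
  (exist (fun k => natural_on (S 0) k) h h0) next.
have FS m n (x : L n) : S m n x -> sval (F m.+1) n x = sval (F m) n x.
  by move=> Sx; apply: (s2valP' (cid2 (ext m _ (svalP (F m))))).
have Smono m m' n (x : L n) : m <= m' -> S m n x -> S m' n x.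
  by move=> /subnK <- ?; elim: (m' - m) => // k IHk; exact: SS.
have Fmono m m' n (x : L n) : m <= m' -> S m n x -> sval (F m') n x = sval (F m) n x.
  move=> /subnK <- Sx; elim: (m' - m) => // k IHk.
  by rewrite FS //; apply: Smono Sx; rewrite leq_addl.
pose g n (x : L n) := sval (F (projT1 (cid (Sall n x)))) n x.
have gE m n (x : L n) : S m n x -> g n x = sval (F m) n x.
  rewrite /g; case: cid => m' Sx' /= Sx.
  by case: (leqP m m') => [le|/ltnW le]; [|apply: esym]; exact: Fmono.
exists g => [p n a x _|n x /gE //].
have [m Sx] := Sall n x; have [m' Sax] := Sall p (act a x).
rewrite (gE (maxn m m')) ?(gE (maxn m m') n x).
- by apply: (svalP (F (maxn m m'))); apply: Smono Sx; exact: leq_maxl.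
- by apply: Smono Sx; exact: leq_maxl.
- by apply: Smono Sax; exact: leq_maxr.
Qed.

Lemma extends_retract (A L L' : sset) (S : spred L) (S' : spred L')
    (i : smap L L') (r : smap L' L) : r ∘s i = sid L ->
  (forall n x, S n x -> S' n (i n x)) -> (forall n x, S' n x -> S n (r n x)) ->
  extends A S' (@sfull L') -> extends A S (@sfull L).
Proof.
move=> ri Si Sr ext h hS.
have [|g gnat gh] := ext (fun n x => h n (r n x)).
  by move=> m n a x /Sr Srx; rewrite snat hS.
exists (fun n x => g n (i n x)) => [m n a x _|n x Sx]; first by rewrite snat gnat.
have rix : r n (i n x) = x by exact: (congr1 (fun f : smap L L => f n x) ri).
by rewrite gh ?rix //; exact: Si.
Qed.

(** Any set-theoretic section of a monotone surjection is monotone. The freedom to pass through [q0]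
    lets a surjection be recovered from its sections. *)
Lemma ord_section m n (s : ordmap n m) (q0 : 'I_n.+1) :
  (forall v, v <= m -> exists q, s q = v :> nat) ->
  exists2 d : ordmap m n, ord_comp s d = ord_id m & d (s q0) = q0.
Proof.
move=> hit.
have /choice[d dP] (v : 'I_m.+1) : exists q, s q = v /\ (v = s q0 -> q = q0).
  case: (eqVneq v (s q0)) => [->|ne]; first by exists q0.
  have [q qv] := hit v (leq_ord v); exists q; split; first exact: val_inj.
  by move=> e; rewrite e eqxx in ne.
have dhomo : {homo d : i j / i <= j}.
  move=> i j ij; case: (leqP (d i) (d j)) => // /[dup] lt /ltnW /(omap_homo s).
  rewrite !(proj1 (dP _)) => ji.
  have e : i = j by apply: val_inj; apply/eqP; rewrite eqn_leq ij.
  by rewrite e ltnn in lt.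
exists (OrdMap dhomo); last exact: (proj2 (dP _)).
by apply: ordmap_eq => v; exact: (proj1 (dP v)).
Qed.

Lemma ord_strict_id m (f : 'I_m.+1 -> 'I_m.+1) :
  (forall i j : 'I_m.+1, i < j -> f i < f j) -> forall i, f i = i.
Proof.
move=> fP.
have lo k : forall i : 'I_m.+1, i = k :> nat -> k <= f i.
  elim: k => // k IHk i ik; have lt : k < m.+1 by have := ltn_ord i; lia.
  have := IHk (Ordinal lt) erefl; have := fP (Ordinal lt) i; rewrite ik /=.
  by move=> /(_ (ltnSn k)); lia.
have hi k : forall i : 'I_m.+1, i + k = m -> f i + k <= m.
  elim: k => [|k IHk] i ik; first by rewrite addn0 -ltnS.
  have lt : i.+1 < m.+1 by lia.
  have := IHk (Ordinal lt); have := fP i (Ordinal lt) (ltnSn i) => /=.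
  by move: (f _ : nat) => c; lia.
move=> i; apply: ord_inj; apply/eqP; rewrite eqn_leq (lo i i erefl) andbT.
by have := hi (m - i) i (subnKC (leq_ord i)); have := leq_ord i; lia.
Qed.

Lemma ord_surj_id m (e : ordmap m m) :
  (forall v, v <= m -> exists q, e q = v :> nat) -> e = ord_id m.
Proof.
move=> hit; have [d ed _] := ord_section ord0 hit.
have edE v : e (d v) = v by exact: (congr1 (fun f : ordmap m m => f v) ed).
have dE : forall v, d v = v.
  apply: ord_strict_id => i j ij; case: (ltnP (d i) (d j)) => // /(omap_homo e).
  by rewrite !edE leqNgt ij.
by apply: ordmap_eq => v; rewrite -[in LHS](dE v) edE.
Qed.

(** * Relative skeletal filtration *)

Section Skeleton.
Variables (L : sset) (K : spred L).
Hypothesis Kcl : sclosed K.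

(** The subcomplex generated by [K] and the simplices of dimension strictly below [m]; thus [skel 0]
    is [K] itself. *)
Definition skel (m : nat) : spred L := fun n x =>
  K x \/ exists q (y : L q) (s : ordmap n q), q < m /\ x = act s y.

Lemma skel_closed m : sclosed (skel m).
Proof.
move=> p n a x [Kx|[q [y [s [qm ->]]]]]; first by left; exact: Kcl.
by right; exists q, y, (ord_comp s a); rewrite act_comp.
Qed.

Lemma skel_misses m n (y : L m) (s : ordmap n m) v :
  v <= m -> misses s v -> skel m (act s y).
Proof.
case: m y s => [|m] y s vm sv.
  by have := sv ord0; rewrite [s _]ord1; case: v vm {sv}.
right; exists m, (act (coface m v) y), (ord_comp (codegen m v) s).
by rewrite -act_comp coface_codegen.
Qed.

Lemma skel_hit m n (y : L m) (s : ordmap n m) : ~ skel m (act s y) ->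
  forall v, v <= m -> exists q, s q = v :> nat.
Proof. by move=> ny v vm; apply: hitP => sv; apply: ny; exact: skel_misses sv. Qed.

Lemma act_section m n (y : L m) (s : ordmap n m) (d : ordmap m n) :
  ord_comp s d = ord_id m -> act d (act s y) = y.
Proof. by move=> e; rewrite -act_comp e act_id. Qed.

(* Eilenberg-Zilber: a simplex outside the skeleton determines the
   nondegenerate simplex and the degeneracy it comes from. *)
Lemma skel_unique m n (y y' : L m) (s s' : ordmap n m) :
  ~ skel m (act s y) -> act s y = act s' y' -> y = y' /\ s = s'.
Proof.
move=> ny e; have hit := skel_hit ny.
(* [y] is the pullback of [y'] along [s' d]; if [s' d] were not onto, [y] would lie in the skeleton,
   and a monotone surjection of [[m]] onto itself is the identity. *)
have key d : ord_comp s d = ord_id m -> ord_comp s' d = ord_id m.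
  move=> sd; apply: ord_surj_id; apply: (@skel_hit m m y').
  rewrite act_comp -e act_section // => yS; apply: ny; exact: skel_closed.
have [d sd _] := ord_section ord0 hit.
split; first by rewrite -(act_section y sd) e act_section // key.
apply: ordmap_eq => q; have [d' /[dup] sd' /key s'd' dq] := ord_section q hit.
by have /= := congr1 (fun f : ordmap m m => f (s q)) s'd'; rewrite dq => ->.
Qed.

Definition skel_prism m : spred (sprod L (Delta 2)) := fun n z =>
  skel m z.1 \/ (misses z.2 0 \/ misses z.2 2).

(** The new cells are the prisms on the [m]-simplices outside [skel m]. A simplex [(s, a)] of such a
    prism is old exactly when [s] is not onto or [a] lies in the horn, which is the condition
    [prism_bd]. *)
Lemma extends_skel_prism (A : qcat) m :
  extends A (skel_prism m) (skel_prism m.+1).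
Proof.
apply: (@extends_glue A _ (sprod (Delta m) (Delta 2)) {y : L m | ~ skel m y}
  (fun y => sprod_map (yoneda (sval y)) (sid (Delta 2)))).
- move=> p n a z [z1|[z2|z2]]; first by left; exact: skel_closed.
  + by right; left => q; exact: z2.
  + by right; right => q; exact: z2.
- move=> n [x a] [/= [Kx|[q [y [s [qm ->]]]]]|/= ha]; [by left; left; left| |by left; right].
  have [qltm|qem] : q < m \/ q = m by lia.
    by left; left; right; exists q, y, s.
  subst q; have [yS|nyS] := pselect (skel m y); first by left; left; exact: skel_closed.
  by right; exists (exist _ y nyS), (s, a).
- move=> [y ny] [y' ny'] n [s a] [s' a'] /= nS [e ea].
  have [|ey es] := @skel_unique m n y y' s s' _ e; first by move=> h; apply: nS; left.
  by split; [exact: eq_exist|rewrite es ea].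
- move=> [y ny]; apply: extends_weaken (@extends_prism A m) => // n [s a] /=.
  split=> [[[v vm sv]|]|[/= yS|]]; [|by right| |by right].
    by left; exact: skel_misses sv.
  left; apply: contrapT => nv; apply: ny.
  have hit v : v <= m -> exists q, s q = v :> nat.
    by move=> vm; apply: hitP => sv; apply: nv; exists v.
  have [d sd _] := ord_section ord0 hit.
  by rewrite -(act_section y sd); exact: skel_closed.
Qed.

Lemma extends_prism_rel (A : qcat) :
  extends A (fun n (z : sprod L (Delta 2) n) => K z.1 \/ (misses z.2 0 \/ misses z.2 2))
    (@sfull (sprod L (Delta 2))).
Proof.
have all0 : extends A (skel_prism 0) (@sfull (sprod L (Delta 2))).
  apply: (@extends_union A _ skel_prism); last exact: extends_skel_prism.
  - move=> m n z [[Kz|[q [y [s [qm e]]]]]|h]; [by left; left| |by right].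
    by left; right; exists q, y, s; split=> //; lia.
  - by move=> n z; exists n.+1; left; right; exists n, z.1, (ord_id n); rewrite act_id.
apply: extends_weaken all0 => // n z.
by split=> [[[Kz|[q [y [s []]]]]|h]|[Kz|h]] //; [left|right|left; left|right].
Qed.

End Skeleton.

(** * Inner horns as retracts of pushout-products *)

Section HornProduct.
Variables (X : sset) (n k : nat).
Hypothesis kn : 0 < k < n.

Lemma retr_row_homo :
  {homo (fun i : 'I_n.+1 => inord ((k <= i) + (k < i)) : 'I_3) : i j / i <= j}.
Proof. by move=> i j ij; rewrite !inordK; do 4?[case: leqP => ? /=]; lia. Qed.

Definition retr_row : ordmap n 2 := OrdMap retr_row_homo.

(** A retraction of [[n] x [2]] onto [[n]]: row 0 truncates at [k] from above, row 1 is constant at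
    [k], row 2 truncates from below. The section places [c] in row 0, 1 or 2 according to [c < k],
    [c = k] or [c > k]. *)
Definition retr_fun (r c : nat) : nat :=
  if r == 0 then minn c k else if r == 1 then k else maxn c k.

Lemma retr_fun_homo m (b : ordmap m n) (a : ordmap m 2) :
  {homo (fun i => inord (retr_fun (a i) (b i)) : 'I_n.+1) : i j / i <= j}.
Proof.
move=> i j /[dup] /(omap_homo a) + /(omap_homo b).
have := ltn_ord (b i); have := ltn_ord (b j).
move: (b i : nat) (b j : nat) (a i : nat) (a j : nat) => bi bj [|[|ai]] [|[|aj]];
  rewrite /retr_fun /= => *; rewrite !inordK; lia.
Qed.

Definition retr_ord m (b : ordmap m n) (a : ordmap m 2) : ordmap m n :=
  OrdMap (@retr_fun_homo m b a).

Lemma retr_ordE m (b : ordmap m n) (a : ordmap m 2) i :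
  retr_ord b a i = retr_fun (a i) (b i) :> nat.
Proof.
apply: inordK; have := ltn_ord (b i).
by move: (b i : nat) (a i : nat) => bi [|[|ai]]; rewrite /retr_fun /=; lia.
Qed.

Definition horn_retr : smap (sprod (sprod X (Delta n)) (Delta 2)) (sprod X (Delta n)).
Proof.
refine (@SMap (sprod (sprod X (Delta n)) (Delta 2)) (sprod X (Delta n))
  (fun m z => (z.1.1, retr_ord z.1.2 z.2)) _).
by move=> m p a [[x b] c] /=; congr pair; exact: ordmap_eq.
Defined.

Definition horn_sect : smap (sprod X (Delta n)) (sprod (sprod X (Delta n)) (Delta 2)) :=
  spair (sid _) (Delta_map retr_row ∘s
    @SMap (sprod X (Delta n)) (Delta n) (fun _ z => z.2) (fun _ _ _ _ => erefl)).

(** The retraction only yields the old vertex or [k], so missing [v != k] is preserved. Without row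
    0 all values are at least [k > 0], so 0 is missed; without row 2 they are at most [k < n], so
    [n] is missed. *)
Lemma extends_horn_prod (A : qcat) :
  extends A (fun m (z : sprod X (Delta n) m) =>
      exists v, [/\ v <= n, v != k & misses z.2 v]) (@sfull (sprod X (Delta n))).
Proof.
apply: (@extends_retract A _ _ _ _ horn_sect horn_retr); last 1 first.
- apply: (@extends_prism_rel _ (fun m (z : sprod X (Delta n) m) =>
      exists v, [/\ v <= n, v != k & misses z.2 v])).
  by move=> m p a z [v [? ? zv]]; exists v; split=> // q; exact: zv.
- apply: smap_eq => m [x b]; congr pair; apply: ordmap_eq => q; apply: val_inj.
  rewrite [LHS]retr_ordE /= inordK; last by do 2?[case: (leqP _ (b q)) => ? /=].
  by rewrite /retr_fun; move: (b q : nat) => c; do 2?[case: leqP => ? /=]; lia.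
- by move=> m [x b] h; left.
- move=> m [[x b] a] /= [[v [vn vk bv]]|[a0|a2]].
  + exists v; split=> // q; rewrite retr_ordE /retr_fun; have := bv q.
    by move: (b q : nat) => c; case: ifP => _; [|case: ifP => _]; lia.
  + exists 0; split=> //; [lia|move=> q; rewrite retr_ordE /retr_fun; have := a0 q].
    by case: ifP => //= _ _; case: ifP => _; lia.
  + exists n; split=> //; [lia|move=> q; rewrite retr_ordE /retr_fun].
    have := a2 q; have := ltn_ord (a q); move: (a q : nat) => [|[|[|r]]] //= _ _.
    by lia.
    by lia.
Qed.

End HornProduct.

Lemma sexp_quasicategory (A : qcat) (X : sset) : is_quasicategory (sexp A X).
Proof.
move=> n k kn h.
have k_in m : in_horn k (ord_const m k).
  by apply/in_hornP; exists 0; split=> [//||_ /=]; lia.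
(* The transpose of [h] must be total on [X x Delta n]; outside the horn it takes its value at the
   constant simplex at [k], which misses 0. *)
pose clamp m (e : ordmap m n) : horn k m :=
  match pselect (in_horn k e) with
  | left p => exist (fun y : ordmap m n => in_horn k y) e p
  | right _ => exist (fun y : ordmap m n => in_horn k y) (ord_const m k) (k_in m)
  end.
have clampE m (e : horn k m) : clamp m (sval e) = e.
  by rewrite /clamp; case: pselect => [p|[]]; [case: e p => e ? p; exact: eq_exist|exact: svalP].
pose H m (z : sprod X (Delta n) m) : A m := h m (clamp m z.2) m (z.1, ord_id m).
have HE m p (x : X p) (e : horn k m) (b : ordmap p m) :
    H p (x, ord_comp (sval e) b) = h m e p (x, b).
  rewrite /H /= (_ : clamp _ _ = act b e); last by rewrite -[RHS]clampE.
  by rewrite snat /=; congr (h m e p (_, _)); exact: ordmap_eq.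
have [|g gnat gH] := @extends_horn_prod X n k kn A H.
  move=> p m a [x e] /in_hornP eP.
  pose E : horn k m := exist (fun y : ordmap m n => in_horn k y) e eP.
  apply: (etrans (HE m p (act a x) E a)).
  have -> : H m (x, e) = h m E m (x, ord_id m).
    by rewrite -HE; congr (H m (_, _)); exact: ordmap_eq.
  by rewrite -snat /=; congr (h m E p (_, _)); exact: ordmap_eq.
pose G : sexp A X n := @SMap (sprod X (Delta n)) A g (fun p m a x => gnat p m a x I).
exists (yoneda G); apply: smap_eq => m e; apply: smap_eq => p [x b] /=.
rewrite gH; last by apply/in_hornP; apply: in_horn_act; exact: svalP.
exact: HE.
Qed.

Definition qexp (A : qcat) (X : sset) : qcat := QCat (@sexp_quasicategory A X).

(** * Homotopy of edges in a quasi-category *)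

Lemma coface_coface n i j : i < j ->
  ord_comp (coface n.+1 i) (coface n j.-1) = ord_comp (coface n.+1 j) (coface n i).
Proof.
move=> ij; apply: ordmap_eq => q; apply: ord_inj.
rewrite [LHS]cofaceE cofaceE [RHS]cofaceE cofaceE /bump.
by move: (q : nat) => c; do 4?[case: leqP => ? /=]; lia.
Qed.

Lemma codegen_coface n v : v <= n.+1 -> ord_comp (codegen n v) (coface n v) = ord_id n.
Proof.
move=> vn; apply: ordmap_eq => q; apply: ord_inj.
by rewrite [LHS]codegenE // ?cofaceE ?bumpK // eq_sym neq_bump.
Qed.

Lemma act_coface_coface (X : sset) n i j (x : X n.+2) : i < j ->
  act (coface n j.-1) (act (coface n.+1 i) x) = act (coface n i) (act (coface n.+1 j) x).
Proof. by move=> ij; rewrite -!act_comp coface_coface. Qed.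

Lemma coface_misses m n v (x : ordmap m n) w :
  misses (ord_comp (coface n v) x) w -> w != v -> misses x (unbump v w).
Proof.
move=> xw wv q; apply: contra (xw q) => /eqP e.
have -> : ord_comp (coface n v) x q = bump v (x q) :> nat by exact: cofaceE.
by rewrite e unbumpKcond (negbTE wv).
Qed.

(** A simplex of the horn missing [v] is evaluated through [y v]; compatibility on the common faces
    makes the result independent of the choice of [v]. *)
Lemma horn_fill (Y : qcat) n k (y : nat -> Y n.+1) : 0 < k < n.+2 ->
  (forall i j, i < j <= n.+2 -> i != k -> j != k ->
     act (coface n j.-1) (y i) = act (coface n i) (y j)) ->
  exists S : Y n.+2, forall v, v <= n.+2 -> v != k -> act (coface n.+1 v) S = y v.
Proof.
move=> kn compat.
pose ok m (e : ordmap m n.+2) v := [/\ v <= n.+2, v != k & misses e v].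
pose H m (e : Delta n.+2 m) : Y m :=
  let v := match pselect (exists v, ok m e v) with
           | left ex => projT1 (cid ex) | right _ => 0 end in
  act (ord_comp (codegen n.+1 v) e) (y v).
have Hlt m (e : ordmap m n.+2) v w : v < w -> ok m e v -> ok m e w ->
    act (ord_comp (codegen n.+1 v) e) (y v) = act (ord_comp (codegen n.+1 w) e) (y w).
  move=> vw [vn vk ev] [wn wk ew].
  (* A simplex missing [v < w] factors through the face opposite to both, where [compat] applies;
     once [v] is removed, [w] has index [w.-1]. *)
  have {2}-> : e = ord_comp (coface n.+1 v) (ord_comp (coface n w.-1)
      (ord_comp (codegen n w.-1) (ord_comp (codegen n.+1 v) e))).
    rewrite coface_codegen ?coface_codegen //; first lia.
    have := @coface_misses _ _ v (ord_comp (codegen n.+1 v) e) w.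
    rewrite coface_codegen // /unbump vw subn1; apply=> //.
    by rewrite neq_ltn vw orbT.
  set e2 := ord_comp (codegen n w.-1) _.
  have -> : ord_comp (coface n.+1 v) (ord_comp (coface n w.-1) e2) =
      ord_comp (coface n.+1 w) (ord_comp (coface n v) e2).
    transitivity (ord_comp (ord_comp (coface n.+1 v) (coface n w.-1)) e2).
      exact: ordmap_eq.
    by rewrite coface_coface //; exact: ordmap_eq.
  have -> : ord_comp (codegen n.+1 w) (ord_comp (coface n.+1 w) (ord_comp (coface n v) e2)) =
      ord_comp (coface n v) e2.
    transitivity (ord_comp (ord_comp (codegen n.+1 w) (coface n.+1 w)) (ord_comp (coface n v) e2)).
      exact: ordmap_eq.
    by rewrite codegen_coface //; exact: ordmap_eq.
  rewrite [RHS]act_comp -compat ?vw // -act_comp; congr act.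
  rewrite /e2 coface_codegen //; first lia.
  have := @coface_misses _ _ v (ord_comp (codegen n.+1 v) e) w.
  rewrite coface_codegen // /unbump vw subn1; apply=> //.
  by rewrite neq_ltn vw orbT.
have HE m (e : ordmap m n.+2) v : ok m e v ->
    H m e = act (ord_comp (codegen n.+1 v) e) (y v).
  rewrite /H; case: pselect => [ex|]; last by move=> + h; case; exists v.
  case: cid => w /= hw hv; case: (ltngtP v w) => [lt|lt|->//].
  - by apply: esym; exact: Hlt.
  - exact: Hlt.
have kn3 : k < n.+3 by lia.
have [|g gnat gH] := @extends_horn Y n.+2 (Ordinal kn3) kn H.
  move=> m p a e /in_hornP[v hv]; rewrite (HE p e v) // (HE m (act a e) v).
    by rewrite -act_comp.
  by case: hv => ? ? ev; split=> // q; exact: ev.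
exists (g n.+2 (ord_id n.+2)) => v vn vk; rewrite -gnat //=.
have -> : ord_comp (ord_id n.+2) (coface n.+1 v) = coface n.+1 v by exact: ordmap_eq.
have okv : ok _ (coface n.+1 v) v.
  by split=> // q; rewrite cofaceE eq_sym neq_bump.
rewrite gH; last by apply/in_hornP; exists v.
by rewrite (HE _ _ v) // codegen_coface // act_id.
Qed.

(** * Composites of edges witnessed by 2-simplices *)

Local Notation d_ n i := (act (coface n i)).

(** Reads: [h] is a composite of [f] followed by [g]. *)
Definition triangle (Y : sset) (f g h : Y 1) :=
  exists s : Y 2, [/\ d_ 1 2 s = f, d_ 1 0 s = g & d_ 1 1 s = h].

Lemma triangle_map (X Y : sset) (F : smap X Y) (f g h : X 1) :
  triangle f g h -> triangle (F 1 f) (F 1 g) (F 1 h).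
Proof. by move=> [s [<- <- <-]]; exists (F 2 s); rewrite !snat. Qed.

Lemma edge01E (Y : sset) (s : Y 2) : edge01 s = d_ 1 2 s.
Proof.
congr act; apply: ordmap_eq => q; apply: ord_inj.
by case: q => [[|[|q]] hq] //=; rewrite inordK.
Qed.

Lemma edge12E (Y : sset) (s : Y 2) : edge12 s = d_ 1 0 s.
Proof.
congr act; apply: ordmap_eq => q; apply: ord_inj.
by case: q => [[|[|q]] hq] //=; rewrite inordK.
Qed.

Lemma edge02E (Y : sset) (s : Y 2) : edge02 s = d_ 1 1 s.
Proof.
congr act; apply: ordmap_eq => q; apply: ord_inj.
by case: q => [[|[|q]] hq] //=; rewrite inordK.
Qed.

Lemma srcE (Y : sset) (e : Y 1) : src e = d_ 0 1 e.
Proof. by congr act; apply: ordmap_eq => q; apply: ord_inj; case: q => [[|q] hq]. Qed.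

Lemma tgtE (Y : sset) (e : Y 1) : tgt e = d_ 0 0 e.
Proof. by congr act; apply: ordmap_eq => q; apply: ord_inj; case: q => [[|q] hq]. Qed.

Lemma src_degen (Y : sset) (x : Y 0) : src (degen x) = x.
Proof.
rewrite /src /degen -act_comp -[RHS]act_id; congr act.
by apply: ordmap_eq => q; rewrite /= [q]ord1.
Qed.

Lemma tgt_degen (Y : sset) (x : Y 0) : tgt (degen x) = x.
Proof.
rewrite /tgt /degen -act_comp -[RHS]act_id; congr act.
by apply: ordmap_eq => q; rewrite /= [q]ord1.
Qed.

Lemma triangle_src (Y : sset) (f g h : Y 1) : triangle f g h -> src f = src h.
Proof.
by move=> [s [<- _ <-]]; rewrite !srcE -(act_coface_coface _ (isT : 1 < 2)).
Qed.

Lemma triangle_mid (Y : sset) (f g h : Y 1) : triangle f g h -> tgt f = src g.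
Proof.
by move=> [s [<- <- _]]; rewrite srcE tgtE -(act_coface_coface _ (isT : 0 < 2)).
Qed.

Lemma triangle_tgt (Y : sset) (f g h : Y 1) : triangle f g h -> tgt g = tgt h.
Proof.
by move=> [s [_ <- <-]]; rewrite !tgtE -(act_coface_coface _ (isT : 0 < 1)).
Qed.

Lemma triangle1f (Y : sset) (e : Y 1) : triangle (degen (src e)) e e.
Proof.
exists (act (codegen 1 0) e); rewrite -!act_comp; split.
- rewrite /degen /src -act_comp; congr act; apply: ordmap_eq => q; apply: ord_inj.
  by case: q => [[|[|q]] hq].
- by rewrite -[RHS]act_id codegen_coface.
- rewrite -[RHS]act_id; congr act; apply: ordmap_eq => q; apply: ord_inj.
  by case: q => [[|[|q]] hq].
Qed.

Lemma trianglef1 (Y : sset) (e : Y 1) : triangle e (degen (tgt e)) e.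
Proof.
exists (act (codegen 1 1) e); rewrite -!act_comp; split.
- rewrite -[RHS]act_id; congr act; apply: ordmap_eq => q; apply: ord_inj.
  by case: q => [[|[|q]] hq].
- rewrite /degen /tgt -act_comp; congr act; apply: ordmap_eq => q; apply: ord_inj.
  by case: q => [[|[|q]] hq].
- by rewrite -[RHS]act_id codegen_coface.
Qed.

Section Calculus.
Variable Y : qcat.
Implicit Types e f g h k l m : Y 1.

Lemma triangle_ex f g : tgt f = src g -> exists k, triangle f g k.
Proof.
move=> fg; have [|S SE] := @horn_fill Y 0 1 (fun v => if v == 0 then g else f) isT.
  move=> [|[|[|i]]] [|[|[|j]]] //= ij _ _; last lia.
  by rewrite -srcE -tgtE fg.
by exists (d_ 1 1 S), S; rewrite (SE 0) // (SE 2).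
Qed.

Lemma horn32 (s012 s023 s123 : Y 2) : d_ 1 1 s012 = d_ 1 2 s023 ->
  d_ 1 0 s012 = d_ 1 2 s123 -> d_ 1 0 s023 = d_ 1 0 s123 ->
  exists S : Y 3, [/\ d_ 2 3 S = s012, d_ 2 1 S = s023 & d_ 2 0 S = s123].
Proof.
move=> e02 e12 e23.
have [|S SE] := @horn_fill Y 1 2
    (fun v => if v == 0 then s123 else if v == 1 then s023 else s012) isT.
  move=> [|[|[|[|i]]]] [|[|[|[|j]]]] //= ij _ _; last lia.
by exists S; rewrite (SE 0) // (SE 1) // (SE 3).
Qed.

Lemma horn31 (s012 s013 s123 : Y 2) : d_ 1 2 s012 = d_ 1 2 s013 ->
  d_ 1 0 s012 = d_ 1 2 s123 -> d_ 1 0 s013 = d_ 1 1 s123 ->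
  exists S : Y 3, [/\ d_ 2 3 S = s012, d_ 2 2 S = s013 & d_ 2 0 S = s123].
Proof.
move=> e01 e12 e13.
have [|S SE] := @horn_fill Y 1 1
    (fun v => if v == 0 then s123 else if v == 2 then s013 else s012) isT.
  move=> [|[|[|[|i]]]] [|[|[|[|j]]]] //= ij _ _; last lia.
by exists S; rewrite (SE 0) // (SE 2) // (SE 3).
Qed.

(* The faces 012, 123 and 023 of a 3-simplex give the face 013. *)
Lemma triangleA f g h k l m : triangle f g k -> triangle g h l ->
  triangle k h m -> triangle f l m.
Proof.
move=> [s [sf sg sk]] [t [tg th tl]] [r [rk rh rm]].
have [|||S [S3 S1 S0]] := @horn32 s r t; try congruence.
exists (d_ 2 2 S); split.
- by rewrite (act_coface_coface S (isT : 2 < 3)) S3.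
- by rewrite -(act_coface_coface S (isT : 0 < 2)) S0.
- by rewrite -(act_coface_coface S (isT : 1 < 2)) S1.
Qed.

(* The faces 012, 123 and 013 of a 3-simplex give the face 023. *)
Lemma triangleB f g h k l m : triangle f g k -> triangle g h l ->
  triangle f l m -> triangle k h m.
Proof.
move=> [s [sf sg sk]] [t [tg th tl]] [r [rf rl rm]].
have [|||S [S3 S2 S0]] := @horn31 s r t; try congruence.
exists (d_ 2 1 S); split.
- by rewrite (act_coface_coface S (isT : 1 < 3)) S3.
- by rewrite -(act_coface_coface S (isT : 0 < 1)) S0.
- by rewrite (act_coface_coface S (isT : 1 < 2)) S2.
Qed.

(** The degenerate edge comes first, opposite to the last vertex, which is the shape that [rsimplex]
    asks for; [triangle_homot] and [homot_triangle] exchange it for a degenerate edge at the end. *)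
Definition homot e e' := triangle (degen (src e)) e' e.

Lemma homotP x e e' : triangle (degen x) e' e -> homot e e'.
Proof. by move=> t; rewrite /homot -(triangle_src t) src_degen. Qed.

Lemma homot_src e e' : homot e e' -> src e' = src e.
Proof. by move/triangle_mid; rewrite tgt_degen. Qed.

Lemma homot_tgt e e' : homot e e' -> tgt e' = tgt e.
Proof. exact: triangle_tgt. Qed.

Lemma triangle_homot e e' x : triangle e (degen x) e' -> homot e e'.
Proof.
move=> /[dup] t /triangle_mid; rewrite src_degen => ex; subst x.
apply: triangleA (triangle1f e) t _; exact: trianglef1.
Qed.

Lemma homot_triangle e e' : homot e e' -> triangle e' (degen (tgt e)) e.
Proof.
move=> /[dup] /homot_src es /[dup] /homot_tgt et t.
apply: triangleB t; first by rewrite -es; exact: triangle1f.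
by rewrite -et; exact: trianglef1.
Qed.

Lemma homot_refl e : homot e e.
Proof. exact: triangle1f. Qed.

Lemma homot_sym e e' : homot e e' -> homot e' e.
Proof. by move=> /homot_triangle /triangle_homot. Qed.

Lemma homot_trans e e' e'' : homot e e' -> homot e' e'' -> homot e e''.
Proof.
move=> h h'; have s := homot_src h.
apply: (@triangleB (degen (src e)) (degen (src e)) e'' (degen (src e)) e' e) => //.
  by have := triangle1f (degen (src e)); rewrite src_degen.
by rewrite -s.
Qed.

Lemma triangle_homot_l f f' g e e' : homot f f' ->
  triangle f g e -> triangle f' g e' -> homot e e'.
Proof. by move=> ff t t'; apply: homotP; apply: triangleA ff t' t. Qed.

Lemma triangle_homot_r f g g' e e' : homot g g' ->
  triangle f g e -> triangle f g' e' -> homot e e'.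
Proof.
move=> /homot_triangle gg t t'; apply: homot_sym; apply: triangle_homot.
exact: triangleB t' gg t.
Qed.

Lemma triangle_congr f f' g g' e e' : homot f f' -> homot g g' ->
  triangle f g e -> triangle f' g' e' -> homot e e'.
Proof.
move=> ff gg t t'.
have [|k tk] := @triangle_ex f' g.
  by rewrite (homot_tgt ff) (triangle_mid t).
exact: homot_trans (triangle_homot_l ff t tk) (triangle_homot_r gg tk t').
Qed.

Lemma triangle_homot_comp f g e e' : triangle f g e -> homot e e' -> triangle f g e'.
Proof.
move=> t ee; have et := homot_tgt ee.
apply: (triangleA t _ (homot_triangle (homot_sym ee))).
by rewrite et -(triangle_tgt t); exact: trianglef1.
Qed.

(** A relation and not a function, since composites exist without being unique; [value_homot] gives
    uniqueness up to homotopy. *)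
Fixpoint value (x y : Y 0) (p : word x y) (e : Y 1) : Prop :=
  match p with
  | wid x => e = degen x
  | wedge _ _ d => e = d
  | wcomp _ _ _ q p => exists f g, [/\ value p f, value q g & triangle f g e]
  end.

Lemma value_src x y (p : word x y) e : value p e -> src e = x.
Proof.
elim: p e => {x y} /= [x e ->|x y d e ->|x y z q _ p IH e [f [g [/IH <- _ /triangle_src]]]] //.
- exact: src_degen.
- exact: edge_src.
Qed.

Lemma value_tgt x y (p : word x y) e : value p e -> tgt e = y.
Proof.
elim: p e => {x y} /= [x e ->|x y d e ->|x y z q IH p _ e [f [g [_ /IH <- /triangle_tgt]]]] //.
- exact: tgt_degen.
- exact: edge_tgt.
Qed.

Lemma value_ex x y (p : word x y) : exists e, value p e.
Proof.
elim: p => {x y} /= [x|x y d|x y z q [g gP] p [f fP]]; [by exists (degen x)|by exists d|].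
have [|k kP] := @triangle_ex f g; first by rewrite (value_tgt fP) (value_src gP).
by exists k, f, g.
Qed.

Lemma value_homot x y (p : word x y) e e' : value p e -> value p e' -> homot e e'.
Proof.
elim: p e e' => {x y} /= [x e e' -> ->|x y d e e' -> ->|]; [exact: homot_refl..|].
move=> x y z q IHq p IHp e e' [f [g [pf qg t]]] [f' [g' [pf' qg' t']]].
exact: triangle_congr (IHp _ _ pf pf') (IHq _ _ qg qg') t t'.
Qed.

(** Soundness of the presentation of [ho Y]: every generating relation of [weq] holds up to homotopy
    of values. This extracts homotopies of edges from equations between morphisms of the homotopy
    category. *)
Lemma weq_homot x y (p q : word x y) e e' :
  weq p q -> value p e -> value q e' -> homot e e'.
Proof.
move=> pq; elim: pq e e' => {x y p q} /=.
- move=> x y p e e'; exact: value_homot.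
- by move=> x y p q _ IH e e' pe qe; apply: homot_sym; exact: IH.
- move=> x y p q r _ IH1 _ IH2 e e' pe re; have [d qd] := value_ex q.
  exact: homot_trans (IH1 _ _ pe qd) (IH2 _ _ qd re).
- move=> x y z q q' p p' _ IHq _ IHp e e' [f [g [pf qg t]]] [f' [g' [pf' qg' t']]].
  exact: triangle_congr (IHp _ _ pf pf') (IHq _ _ qg qg') t t'.
- move=> x y p e e' [f [g [pf -> t]]] pe'.
  exact: homot_trans (homot_sym (triangle_homot t)) (value_homot pf pe').
- move=> x y p e e' [f [g [-> pg t]]] pe'.
  exact: homot_trans (homotP t) (value_homot pg pe').
- move=> x y z t r q p e e' [f [g [[f1 [g1 [pf1 qg1 t1]]] rg te]]].
  move=> [f2 [g2 [pf2 [g3 [h3 [qg3 rh3 t3]]] te']]].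
  (* A composite for the other bracketing; [triangleA] shows that it leads to the same edge [e], up
     to the choices made for [e']. *)
  have [l tl] : exists l, triangle g1 g l.
    by apply: triangle_ex; rewrite (value_tgt qg1) (value_src rg).
  have tm := triangleA t1 tl te.
  have ll : homot l g2.
    exact: triangle_congr (value_homot qg1 qg3) (value_homot rg rh3) tl t3.
  exact: triangle_congr (value_homot pf1 pf2) ll tm te'.
- move=> x e de e' e'' -> ->; rewrite de; exact: homot_refl.
- move=> x y z f g k s; rewrite edge01E edge12E edge02E => sf sg sk e e'.
  move=> [f' [g' [-> -> t]]] ->.
  by apply: (triangle_congr (homot_refl _) (homot_refl _) t); exists s.
Qed.

Definition rep (x y : ho Y) (a : hom x y) (e : Y 1) :=
  exists2 d : edge x y, d = e :> Y 1 & ho_edge d = a.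

Lemma value_rep x y (p : word x y) e : value p e -> rep (wclass p : @hom (ho Y) x y) e.
Proof.
move=> pe; exists (Edge (value_src pe) (value_tgt pe)) => //.
apply/wclassP; apply: weq_sym.
elim: p e pe => {x y} /= [x e ed|x y d e ed|x y z q IHq p IHp e /[dup] epq [f [g [pf qg t]]]].
- by subst e; apply: weq_sym; exact: weq_degen.
- rewrite (_ : Edge _ _ = d); first exact: weq_refl.
  exact: edge_eq.
- apply: weq_trans (weq_comp (IHq _ qg) (IHp _ pf)) _.
  case: t => s [sf sg se].
  by apply: (@weq_simplex _ _ _ _ _ _ _ s); rewrite ?edge01E ?edge12E ?edge02E.
Qed.

Lemma rep_ex (x y : ho Y) (a : hom x y) : exists e, rep a e.
Proof.
have [e ve] := value_ex (wrepr a); exists e.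
by rewrite -[a]wreprK; exact: value_rep.
Qed.

Lemma rep_homot (x y : ho Y) (a : hom x y) e e' : rep a e -> rep a e' -> homot e e'.
Proof.
move=> [d <- <-] [d' <- /wclassP h].
by apply: homot_sym; apply: (weq_homot h).
Qed.

Lemma rep_comp (x y z : ho Y) (b : hom y z) (a : hom x y) f g e :
  rep a f -> rep b g -> triangle f g e -> rep (b ∘m a) e.
Proof.
move=> [d df da] [d' dg db] t.
have <- : wclass (wcomp (wedge d') (wedge d)) = b ∘m a.
  by rewrite wclassM -da -db.
by apply: value_rep; exists f, g.
Qed.

Lemma rep_idm (x : ho Y) : rep (idm x) (degen x).
Proof. exact: (@value_rep _ _ (wid (x : Y 0))). Qed.

Lemma rep_src (x y : ho Y) (a : hom x y) e : rep a e -> src e = x.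
Proof. by move=> [d <- _]; exact: edge_src. Qed.

Lemma rep_tgt (x y : ho Y) (a : hom x y) e : rep a e -> tgt e = y.
Proof. by move=> [d <- _]; exact: edge_tgt. Qed.

End Calculus.

Lemma rep_castm (Y : qcat) (x x' y y' : ho Y) (ex : x = x') (ey : y = y')
    (a : hom x y) e : rep a e -> rep (castm ex ey a) e.
Proof. by case: _ / ex; case: _ / ey. Qed.

Lemma rep_fmap (X Y : qcat) (F : smap X Y) (x y : ho X) (a : hom x y) e :
  rep a e -> rep (fmap (ho_map F) a) (F 1 e).
Proof.
move=> [d <- <-]; exists (edge_map F d) => //.
by apply/wclassP; apply: weq_sym; exact: (word_map_weq F (weq_repr _)).
Qed.

(** * Comma objects *)

Lemma sval_inj_prop (T : Type) (P : T -> Prop) (x y : {z : T | P z}) :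
  sval x = sval y -> x = y.
Proof. by case: x y => [x px] [y py]; exact: eq_exist. Qed.

Lemma sappP (X Y : sset) (h k : smap X Y) n (x : X n) : h = k -> h n x = k n x.
Proof. by move->. Qed.

Lemma src_app (X Y : sset) (e : sexp Y X 1) (h : smap X Y) : src e = vtx h ->
  forall n (x : X n), e n (x, ord_const n ord0) = h n x.
Proof.
move=> eh n x; rewrite -[RHS](@sappP (sprod X (Delta 0)) Y _ _ n (x, ord_const n ord0) eh) /=.
by congr (e n (_, _)); exact: ordmap_eq.
Qed.

Lemma tgt_app (X Y : sset) (e : sexp Y X 1) (h : smap X Y) : tgt e = vtx h ->
  forall n (x : X n), e n (x, ord_const n ord_max) = h n x.
Proof.
move=> eh n x; rewrite -[RHS](@sappP (sprod X (Delta 0)) Y _ _ n (x, ord_const n ord0) eh) /=.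
by congr (e n (_, _)); exact: ordmap_eq.
Qed.

Lemma src_map (X Y : sset) (F : smap X Y) (e : X 1) : src (F 1 e) = F 0 (src e).
Proof. by rewrite /src snat. Qed.

Lemma tgt_map (X Y : sset) (F : smap X Y) (e : X 1) : tgt (F 1 e) = F 0 (tgt e).
Proof. by rewrite /tgt snat. Qed.

Lemma degen_map (X Y : sset) (F : smap X Y) (x : X 0) : F 1 (degen x) = degen (F 0 x).
Proof. by rewrite /degen snat. Qed.

(** The restriction of the square [h_t (k_s)] to the [n]-simplex of [Delta 1 x Delta 1] with
    coordinates [s = b] and [t = a]. *)
Definition hcomp n (X C D : sset) (h : sexp D C 1) (k : sexp C X 1)
    (a b : ordmap n 1) : sexp D X n.
Proof.
refine (@SMap (sprod X (Delta n)) D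
  (fun m z => h m (k m (z.1, ord_comp b z.2), ord_comp a z.2)) _).
move=> m p c [x e] /=; rewrite -snat /= -snat /=.
by congr (h m (k m (_, _), _)); exact: ordmap_eq.
Defined.

(* The two triangles of the square [(s, t) |-> h_t (k_s)]. *)
Lemma interchange (X C D : sset) (h : sexp D C 1) (k : sexp C X 1)
    (h0 h1 : smap C D) (k0 k1 : smap X C) :
  src h = vtx h0 -> tgt h = vtx h1 -> src k = vtx k0 -> tgt k = vtx k1 ->
  exists e : sexp D X 1,
    triangle (post X h0 1 k) (pre D k1 1 h) e /\
    triangle (pre D k0 1 h) (post X h1 1 k) e.
Proof.
move=> hs ht ks kt; exists (hcomp h k (ord_id 1) (ord_id 1)).
split; [exists (hcomp h k (codegen 1 0) (codegen 1 1))|exists (hcomp h k (codegen 1 1) (codegen 1 0))].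
all: split; apply: smap_eq => n [x e] /=.
- rewrite -(src_app hs); congr (h n (k n (_, _), _)); apply: ordmap_eq => q; apply: ord_inj => /=.
    by case: (e q) => [[|[|v]] lt].
  by case: (e q) => [[|[|v]] lt].
- rewrite -(tgt_app kt); congr (h n (k n (_, _), _)); apply: ordmap_eq => q; apply: ord_inj => /=.
    by case: (e q) => [[|[|v]] lt].
  by case: (e q) => [[|[|v]] lt].
- congr (h n (k n (_, _), _)); apply: ordmap_eq => q; apply: ord_inj => /=.
    by case: (e q) => [[|[|v]] lt].
  by case: (e q) => [[|[|v]] lt].
- rewrite -(src_app ks); congr (h n (k n (_, _), _)); apply: ordmap_eq => q; apply: ord_inj => /=.
    by case: (e q) => [[|[|v]] lt].
  by case: (e q) => [[|[|v]] lt].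
- rewrite -(tgt_app ht); congr (h n (k n (_, _), _)); apply: ordmap_eq => q; apply: ord_inj => /=.
    by case: (e q) => [[|[|v]] lt].
  by case: (e q) => [[|[|v]] lt].
- congr (h n (k n (_, _), _)); apply: ordmap_eq => q; apply: ord_inj => /=.
    by case: (e q) => [[|[|v]] lt].
  by case: (e q) => [[|[|v]] lt].
Qed.

Section Comma.
Variables (A B C : sset) (f : smap B A) (g : smap C A).
Local Notation E := (comma f g).

Definition comma1 : smap E C := sfst C B ∘s comma_proj f g.
Definition comma0 : smap E B :=
  @SMap (sprod C B) B (fun _ p => p.2) (fun _ _ _ _ => erefl) ∘s comma_proj f g.

(** The tautological edge from [f p_0] to [g p_1], obtained by evaluating the path component of a
    simplex of the comma object. *)
Definition comma_edge : sexp A E 1.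
Proof.
refine (@SMap (sprod E (Delta 1)) A (fun n z => (sval z.1).1 n (z.2, ord_id n)) _).
move=> m n a [z d] /=; rewrite -snat /=.
by congr ((sval z).1 m (_, _)); exact: ordmap_eq.
Defined.

Lemma src_comma_edge : src comma_edge = vtx (f ∘s comma0).
Proof.
apply: smap_eq => n [[[s [c b]] sP] e] /=.
have /= <- := congr1 snd sP.
by congr (s n (_, _)); exact: ordmap_eq.
Qed.

Lemma tgt_comma_edge : tgt comma_edge = vtx (g ∘s comma1).
Proof.
apply: smap_eq => n [[[s [c b]] sP] e] /=.
have /= <- := congr1 fst sP.
by congr (s n (_, _)); exact: ordmap_eq.
Qed.

Section Lift.
Variables (Z : sset) (s : sexp A Z 1) (c : smap Z C) (b : smap Z B).
Hypothesis sP : src s = vtx (f ∘s b) /\ tgt s = vtx (g ∘s c).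

Definition comma_cyl n (z : Z n) : sexp A (Delta 1) n.
Proof.
refine (@SMap (sprod (Delta 1) (Delta n)) A (fun m y => s m (act y.2 z, y.1)) _).
by move=> m p a [d e] /=; rewrite -snat /= -act_comp.
Defined.

Lemma comma_cylP n (z : Z n) : spair (scod A) (sdom A) n (comma_cyl z) =
  sprod_map g f n (c n z, b n z).
Proof.
congr pair; rewrite /= act_id; [rewrite -[RHS](tgt_app sP.2)|rewrite -[RHS](src_app sP.1)].
all: by congr (s n (_, _)); exact: ordmap_eq.
Qed.

(** The universal property: an edge of [A^Z] from [f b] to [g c] is the restriction of the
    tautological edge along a map over [(c, b)], unique by [comma_map_eq]. *)
Definition comma_lift : smap Z E.
Proof.
refine (@SMap Z E (fun n z => exist _ (comma_cyl z, (c n z, b n z)) (comma_cylP z)) _).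
move=> m n a z; apply: eq_exist; congr pair; last by rewrite /= !snat.
by apply: smap_eq => p [d e] /=; rewrite act_comp.
Defined.

Lemma comma_lift_edge : pre A comma_lift 1 comma_edge = s.
Proof. by apply: smap_eq => n [z d] /=; rewrite act_id. Qed.

End Lift.

Lemma comma_map_eq (Z : sset) (h k : smap Z E) :
  pre A h 1 comma_edge = pre A k 1 comma_edge ->
  comma_proj f g ∘s h = comma_proj f g ∘s k -> h = k.
Proof.
move=> e p; apply: smap_eq => n z; apply: sval_inj_prop.
rewrite [LHS]surjective_pairing [RHS]surjective_pairing; congr pair; last exact: (sappP z p).
apply: smap_eq => m [d a].
have key (l : smap Z E) : (sval (l n z)).1 m (d, a) = pre A l 1 comma_edge m (act a z, d).
  by rewrite /= snat /=; congr ((sval (l n z)).1 m (_, _)); exact: ordmap_eq.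
by rewrite !key e.
Qed.

End Comma.

(** * Invertible edges over the base between maps into a comma object *)

Section CommaIso.
Variables (A : qcat) (B C X : sset) (f : smap B A) (g : smap C A).
Variables (b : smap X B) (c : smap X C).
Local Notation E := (comma f g).

Lemma join_homo m n (a : ordmap m n) :
  {homo (fun i : 'I_m.+2 => if i <= m then widen_ord (leqnSn n.+1) (a (inord i)) else ord_max)
    : i j / i <= j}.
Proof.
move=> i j ij; case: (leqP i m) => im; case: (leqP j m) => jm //=; last lia.
  by apply: (omap_homo a); rewrite !inordK.
by rewrite ltnW.
Qed.

(** The join of [a] with the identity of [[0]]: the added last vertex goes to the added last
    vertex. *)
Definition join1 m n (a : ordmap m n) : ordmap m.+1 n.+1 := OrdMap (join_homo a).

Lemma join1E m n (a : ordmap m n) (i : 'I_m.+2) :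
  join1 a i = (if i <= m then a (inord i) : nat else n.+1) :> nat.
Proof. by rewrite /=; case: (leqP i m). Qed.

Lemma join1_coface n v : v <= n.+1 -> join1 (coface n v) = coface n.+1 v.
Proof.
move=> vn; apply: ordmap_eq => q; apply: ord_inj; rewrite [RHS]cofaceE join1E.
have := ltn_ord q; case: (leqP q n) => qn ?; first by rewrite cofaceE inordK.
by rewrite /bump (_ : v <= q = true) /=; lia.
Qed.

Lemma cone_homo m n (e : ordmap m n) (d : ordmap m 1) :
  {homo (fun q => if d q == ord0 then widen_ord (leqnSn n.+1) (e q) else ord_max)
    : i j / i <= j}.
Proof.
move=> i j ij; have := omap_homo d ij; have := omap_homo e ij.
case: (d i) (d j) => [[|[|di]] hi] [[|[|dj]] hj] //= _ _.
by rewrite ltnW.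
Qed.

(** The map from [Delta n x Delta 1] to [Delta n.+1] that is the last face at the end 0 and
    collapses the end 1 to the last vertex. *)
Definition cone m n (e : ordmap m n) (d : ordmap m 1) : ordmap m n.+1 :=
  OrdMap (cone_homo e d).

Lemma coneE m n (e : ordmap m n) (d : ordmap m 1) q :
  cone e d q = (if d q == ord0 then e q : nat else n.+1) :> nat.
Proof. by rewrite /=; case: ifP. Qed.

(* An [n]-simplex of the mapping space from [f b] to [g c] in [A^X], presented
   as an [n.+1]-simplex with the face opposite to the last vertex degenerate. *)
Definition rsimplex n (t : sexp A X n.+1) :=
  (forall m (x : X m) (e : ordmap m n),
     t m (x, ord_comp (coface n n.+1) e) = f m (b m x)) /\
  (forall m (x : X m), t m (x, ord_const m ord_max) = g m (c m x)).

Definition rsimplex_cyl n (t : sexp A X n.+1) : sexp A (sprod X (Delta n)) 1.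
Proof.
refine (@SMap (sprod (sprod X (Delta n)) (Delta 1)) A
  (fun m z => t m (z.1.1, cone z.1.2 z.2)) _).
by move=> m p a [[x e] d]; rewrite /= -snat; congr (t m (_, _)); exact: ordmap_eq.
Defined.

Lemma rsimplex_cylP n (t : sexp A X n.+1) : rsimplex t ->
  src (rsimplex_cyl t) = vtx (f ∘s (b ∘s sfst X (Delta n))) /\
  tgt (rsimplex_cyl t) = vtx (g ∘s (c ∘s sfst X (Delta n))).
Proof.
move=> [t0 t1]; split; apply: smap_eq => m [[x e] d] /=.
  rewrite -(t0 m x e); congr (t m (_, _)); apply: ordmap_eq => q; apply: ord_inj.
  rewrite [RHS]cofaceE [LHS]coneE /bump; have := ltn_ord (e q).
  by case: (leqP n.+1 (e q)) => /=; lia.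
rewrite -(t1 m x); congr (t m (_, _)); exact: ordmap_eq.
Qed.

(** The ends of the cylinder do not depend on the [Delta n] coordinate, so the classified simplex of
    [E^X] lies over the degenerate simplex at [(c, b)]. *)
Definition rsimplex_lift n (t : sexp A X n.+1) (tP : rsimplex t) : sexp E X n :=
  comma_lift (rsimplex_cylP tP).

Lemma rsimplex_act m n (a : ordmap m n) (t : sexp A X n.+1) :
  rsimplex t -> rsimplex (act (join1 a) t).
Proof.
move=> [t0 t1]; split=> [p x e|p x] /=.
  rewrite -(t0 p x (ord_comp a e)); congr (t p (_, _)); apply: ordmap_eq => q; apply: ord_inj.
  rewrite [RHS]cofaceE [LHS]join1E cofaceE.
  have bumpS k (i : 'I_k.+1) : bump k.+1 i = i by rewrite /bump; have := ltn_ord i; lia.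
  by rewrite !bumpS -ltnS ltn_ord inord_val.
rewrite -(t1 p x); congr (t p (_, _)); apply: ordmap_eq => q; apply: ord_inj.
by rewrite [LHS]join1E /= ltnn.
Qed.

Lemma rsimplex_lift_act m n (a : ordmap m n) (t : sexp A X n.+1) (tP : rsimplex t)
    (atP : rsimplex (act (join1 a) t)) :
  act a (rsimplex_lift tP) = rsimplex_lift atP.
Proof.
apply: comma_map_eq; last by apply: smap_eq.
apply: smap_eq => p [[x e] d] /=; rewrite act_id.
congr (t p (_, _)); apply: ordmap_eq => q; apply: ord_inj.
rewrite [LHS]coneE [RHS]join1E coneE; case: ifP => dq; last by rewrite ltnn.
rewrite -ltnS ltn_ord; congr (nat_of_ord (a _)); apply: ord_inj.
by rewrite inordK; [|exact: ltn_ord].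
Qed.

Lemma rsimplex_lift_eq n (t t' : sexp A X n.+1) (tP : rsimplex t) (tP' : rsimplex t') :
  t = t' -> rsimplex_lift tP = rsimplex_lift tP'.
Proof. by move=> e; subst t'; rewrite (Prop_irrelevance tP tP'). Qed.

Lemma join1_src : join1 (ord_const 0 (ord0 : 'I_2)) = coface 1 1.
Proof.
apply: ordmap_eq => q; apply: ord_inj; rewrite [LHS]join1E [RHS]cofaceE.
by case: q => [[|[|q]] hq].
Qed.

Lemma join1_tgt : join1 (ord_const 0 (ord_max : 'I_2)) = coface 1 0.
Proof.
apply: ordmap_eq => q; apply: ord_inj; rewrite [LHS]join1E [RHS]cofaceE.
by case: q => [[|[|q]] hq].
Qed.

Lemma join1_degen : join1 (ord_const 1 (ord0 : 'I_1)) = codegen 1 0.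
Proof.
apply: ordmap_eq => q; apply: ord_inj; rewrite [LHS]join1E.
by case: q => [[|[|[|q]]] hq].
Qed.

Lemma rsimplex_edge (t : sexp A X 2) : rsimplex t <->
  d_ 1 2 t = degen (vtx (f ∘s b)) /\ tgt (d_ 1 0 t) = vtx (g ∘s c).
Proof.
split=> [[t0 t1]|[t0 t1]]; split.
- by apply: smap_eq => m [x e]; exact: t0.
- apply: smap_eq => m [x e] /=; rewrite -t1; congr (t m (_, _)).
  by apply: ordmap_eq => q; apply: ord_inj.
- move=> m x e; exact: (@sappP (sprod X (Delta 1)) A _ _ m (x, e) t0).
- move=> m x; apply: etrans _ (tgt_app t1 x); rewrite /=; congr (t m (_, _)).
  by apply: ordmap_eq => q; apply: ord_inj.
Qed.

Lemma rsimplex0 (t : sexp A X 1) : rsimplex t <->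
  src t = vtx (f ∘s b) /\ tgt t = vtx (g ∘s c).
Proof.
split=> [[t0 t1]|[t0 t1]]; split.
- apply: smap_eq => m [x e] /=; rewrite -(t0 m x e); congr (t m (_, _)).
  by apply: ordmap_eq => q; apply: ord_inj; rewrite /= [e q]ord1.
- apply: smap_eq => m [x e] /=; rewrite -t1; congr (t m (_, _)).
- move=> m x e; apply: etrans _ (src_app t0 x); congr (t m (_, _)).
  by apply: ordmap_eq => q; apply: ord_inj; rewrite /= [e q]ord1.
- move=> m x; apply: etrans _ (tgt_app t1 x); rewrite /=; congr (t m (_, _)).
Qed.

(* Right lifting against the outer horn of dimension 2 at the vertex 2 for
   these mapping spaces amounts to filling an inner horn of dimension 3. *)
Lemma rsimplex_right_inverse (s : sexp A X 2) (sP : rsimplex s) :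
  exists (s' : sexp A X 2) (sP' : rsimplex s') (aP : rsimplex (d_ 1 0 s)),
    [/\ d_ 1 0 s' = d_ 1 1 s, d_ 1 1 s' = d_ 1 0 s &
      triangle (rsimplex_lift sP') (rsimplex_lift sP) (degen (rsimplex_lift aP))].
Proof.
have [s2 st] := (rsimplex_edge s).1 sP.
pose v : sexp A X 0 := vtx (f ∘s b).
have d2_0 : d_ 1 0 (act (ord_const 2 ord0) v) = degen v.
  by rewrite -act_comp; congr act; exact: ordmap_eq.
have d2_1 : d_ 1 1 (act (ord_const 2 ord0) v) = degen v.
  by rewrite -act_comp; congr act; exact: ordmap_eq.
have srcs : src (d_ 1 0 s) = v.
  by rewrite srcE (act_coface_coface s (isT : 0 < 2)) s2 -tgtE tgt_degen.
have [e2 e0 e1] : [/\ d_ 1 2 (act (codegen 1 0) (d_ 1 0 s)) = degen v,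
   d_ 1 0 (act (codegen 1 0) (d_ 1 0 s)) = d_ 1 0 s &
   d_ 1 1 (act (codegen 1 0) (d_ 1 0 s)) = d_ 1 0 s].
  move: (d_ 1 0 s) srcs => e <-; rewrite -!act_comp; split.
  - rewrite /degen /src -act_comp; congr act; apply: ordmap_eq => q; apply: ord_inj.
    by case: q => [[|[|q]] hq].
  - by rewrite -[RHS]act_id codegen_coface.
  - rewrite -[RHS]act_id; congr act; apply: ordmap_eq => q; apply: ord_inj.
    by case: q => [[|[|q]] hq].
(* The face [012] is constant at [f b], [123] is [s], and [023] is degenerate on the edge
   [d_ 1 0 s]. The filled face [013] is the right inverse. *)
have [T [T3 T1 T0]] := @horn32 (qexp A X) (act (ord_const 2 ord0) v)
  (act (codegen 1 0) (d_ 1 0 s)) s (etrans d2_1 (esym e2)) (etrans d2_0 (esym s2)) e0.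
have TP : rsimplex T.
  split=> [m x e|m x].
    exact: (@sappP (sprod X (Delta 2)) A _ _ m (x, e) T3).
  rewrite -(sP.2 m x) -T0 /=; congr (T m (_, _)).
  by apply: ordmap_eq => q; apply: ord_inj.
have faceP i : i <= 2 -> rsimplex (d_ 2 i T).
  by move=> i2; rewrite -(join1_coface i2); exact: rsimplex_act.
have aP : rsimplex (d_ 1 0 s) by apply/rsimplex0.
exists (d_ 2 2 T), (faceP 2 isT), aP; split.
- by rewrite -(act_coface_coface T (isT : 0 < 2)) T0.
- by rewrite -(act_coface_coface T (isT : 1 < 2)) T1 e1.
have liftE i (i2 : i <= 2) (jP : rsimplex (act (join1 (coface 1 i)) T)) :
    rsimplex_lift jP = rsimplex_lift (faceP i i2).
  by apply: rsimplex_lift_eq; rewrite join1_coface.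
have jP i : rsimplex (act (join1 (coface 1 i)) T) by exact: rsimplex_act.
(* Lifting commutes with faces through [join1], so the lift of [T] is a 2-simplex of [E^X] whose
   faces are the lifts of [013], [123] and the degenerate [023]. *)
exists (rsimplex_lift TP); split; rewrite (rsimplex_lift_act TP (jP _)) liftE //.
- by apply: rsimplex_lift_eq.
- by apply: rsimplex_lift_eq.
- have dP : rsimplex (act (join1 (ord_const 1 ord0)) (d_ 1 0 s)) by exact: rsimplex_act.
  rewrite /degen (rsimplex_lift_act aP dP).
  by apply: rsimplex_lift_eq; rewrite T1 join1_degen.
Qed.

(** The 2-simplex witnessing the homotopy is an [rsimplex] of dimension 1, and its lift is the edge.
    Its right inverse has a right inverse in turn, which makes both two-sided. *)
Lemma comma_iso (h k : smap X E) :
  comma_proj f g ∘s h = spair c b -> comma_proj f g ∘s k = spair c b ->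
  @homot (qexp A X) (pre A h 1 (comma_edge f g)) (pre A k 1 (comma_edge f g)) ->
  exists e : edge (vtx h) (vtx k),
    iso_edge e /\ is_degenerate1 (post X (comma_proj f g) 1 e).
Proof.
move=> hp kp; set a := pre A h 1 _; set a' := pre A k 1 _.
have pre_rsimplex (l : smap X E) : comma_proj f g ∘s l = spair c b ->
    rsimplex (pre A l 1 (comma_edge f g)).
  move=> lp; apply/rsimplex0; rewrite src_map tgt_map src_comma_edge tgt_comma_edge.
  split; apply: smap_eq => m [x e] /=; congr (_ m _).
    exact: (congr1 (fun z : smap X (sprod C B) => (z m x).2) lp).
  exact: (congr1 (fun z : smap X (sprod C B) => (z m x).1) lp).
have vtxE (l : smap X E) (lp : comma_proj f g ∘s l = spair c b) t (tP : rsimplex t) :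
    t = pre A l 1 (comma_edge f g) -> rsimplex_lift tP = vtx l.
  move=> tE; apply: comma_map_eq; last first.
    by apply: smap_eq => m [x e]; exact: esym (sappP x lp).
  rewrite comma_lift_edge tE; apply: smap_eq => m [[x e] d] /=; congr ((sval (l m x)).1 m (_, _)).
  apply: ordmap_eq => q; apply: ord_inj; rewrite [LHS]coneE [e q]ord1.
  by case: (d q) => [[|[|?]] ?].
move=> [s [s2 s0 s1]].
have aP := pre_rsimplex h hp; have aP' := pre_rsimplex k kp.
have [asrc atgt] := (rsimplex0 _).1 aP; have [asrc' atgt'] := (rsimplex0 _).1 aP'.
have sP : rsimplex s.
  by apply/rsimplex_edge; rewrite s2 s0; split=> //; rewrite asrc.
have ends (l l' : smap X E) (lp : comma_proj f g ∘s l = spair c b)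
    (lp' : comma_proj f g ∘s l' = spair c b) t (tP : rsimplex t) :
    d_ 1 1 t = pre A l 1 (comma_edge f g) -> d_ 1 0 t = pre A l' 1 (comma_edge f g) ->
    src (rsimplex_lift tP) = vtx l /\ tgt (rsimplex_lift tP) = vtx l'.
  move=> t1 t0; split.
    rewrite /src (rsimplex_lift_act tP (rsimplex_act _ tP)).
    by apply: vtxE => //; rewrite join1_src.
  rewrite /tgt (rsimplex_lift_act tP (rsimplex_act _ tP)).
  by apply: vtxE => //; rewrite join1_tgt.
(* The right inverse is returned again as a lift with known end faces, so that this statement can be
   applied to it once more. *)
have inv (l l' : smap X E) (lp : comma_proj f g ∘s l = spair c b)
    (lp' : comma_proj f g ∘s l' = spair c b) t (tP : rsimplex t) (e : edge (vtx l) (vtx l')) :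
    d_ 1 1 t = pre A l 1 (comma_edge f g) -> d_ 1 0 t = pre A l' 1 (comma_edge f g) ->
    e = rsimplex_lift tP :> sexp E X 1 ->
    exists t' (tP' : rsimplex t') (e' : edge (vtx l') (vtx l)),
      [/\ d_ 1 1 t' = pre A l' 1 (comma_edge f g), d_ 1 0 t' = pre A l 1 (comma_edge f g),
        e' = rsimplex_lift tP' :> sexp E X 1 & ho_edge e ∘m ho_edge e' = @idm (ho (sexp E X)) (vtx l')].
  move=> t1 t0 et; have [t' [tP' [aP0 [t'0 t'1 [r [r2 r0 r1]]]]]] := rsimplex_right_inverse tP.
  have [es et'] := ends l' l lp' lp t' tP' (etrans t'1 t0) (etrans t'0 t1).
  exists t', tP', (Edge es et'); split=> //; [by rewrite t'1|by rewrite t'0|].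
  rewrite -wclassM; apply/wclassP.
  have ds : src (degen (vtx l')) = vtx l' by exact: src_degen.
  have dt : tgt (degen (vtx l')) = vtx l' by exact: tgt_degen.
  apply: (@weq_trans _ _ _ _ (wedge (Edge ds dt))); last exact: weq_degen.
  apply: (@weq_simplex _ _ _ _ _ _ _ r); rewrite ?edge01E ?edge12E ?edge02E //.
    by rewrite r0 et.
  by rewrite r1 (vtxE l').
have [es et] := ends h k hp kp s sP s1 s0.
exists (Edge es et); split; last first.
  exists (vtx (spair c b)); exact: smap_eq.
have [t [tP [e' [t1 t0 e't ee']]]] := inv h k hp kp s sP (Edge es et) s1 s0 erefl.
have [_ [_ [e'' [_ _ _ e'e'']]]] := inv k h kp hp t tP e' t1 t0 e't.
exists (ho_edge e'); split=> //.
(* The usual argument: [e = e (e' e'') = (e e') e'' = e''], hence [e' e = e' e'' = 1]. *)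
rewrite -[RHS]e'e''; congr (_ ∘m _).
by rewrite -[LHS]compm1 -e'e'' compA ee' comp1m.
Qed.

End CommaIso.

(** * Adjunctions *)

Definition rep2 (X : sset) (Y : qcat) (h k : smap X Y) (a : twocell h k) (e : sexp Y X 1) :=
  @rep (qexp Y X) (vtx h) (vtx k) a e.

Lemma rep2_eq_l (X : sset) (Y : qcat) (h k l : smap X Y) (kl : k = l)
    (a : twocell h k) e : rep2 a e -> rep2 (twocell_comp (twocell_of_eq kl) a) e.
Proof. by case: _ / kl; rewrite /twocell_comp comp1m. Qed.

Lemma rep2_eq_r (X : sset) (Y : qcat) (h k l : smap X Y) (hk : h = k)
    (a : twocell k l) e : rep2 a e -> rep2 (twocell_comp a (twocell_of_eq hk)) e.
Proof. by case: _ / hk a => a; rewrite /twocell_comp compm1. Qed.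

Lemma rep2_whisker_l (X : sset) (Y Z : qcat) (g : smap Y Z) (h k : smap X Y)
    (a : twocell h k) e : rep2 a e -> rep2 (whisker_l g a) (post X g 1 e).
Proof. by move=> ae; apply: (@rep_castm (qexp Z X)); exact: (@rep_fmap (qexp Y X) (qexp Z X) (post X g) _ _ a e ae). Qed.

Lemma rep2_whisker_r (X Y : sset) (Z : qcat) (g g' : smap Y Z) (a : twocell g g')
    (h : smap X Y) e : rep2 a e -> rep2 (whisker_r a h) (pre Z h 1 e).
Proof. by move=> ae; apply: (@rep_castm (qexp Z X)); exact: (@rep_fmap (qexp Z Y) (qexp Z X) (pre Z h) _ _ a e ae). Qed.

(** Some composite of [d] and [e] represents the identity, hence is homotopic to the degenerate
    edge, which can then replace it as the composite. *)
Lemma rep2_triangle (X : sset) (Y : qcat) (h k : smap X Y)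
    (a : twocell h k) (b : twocell k h) d e :
  twocell_comp b a = twocell_id h -> rep2 a d -> rep2 b e ->
  triangle d e (degen (vtx h)).
Proof.
move=> ba ad be; have [|m t] := @triangle_ex (qexp Y X) d e.
  by rewrite (rep_tgt ad) (rep_src be).
apply: (triangle_homot_comp t).
apply: (rep_homot (rep_comp ad be t)).
rewrite -[comp _ _]/(twocell_comp b a) ba.
exact: rep_idm.
Qed.

(** Edges representing the unit and the counit are chosen. Composing with a [twocell_of_eq] keeps
    the representing edge, so the coherence cells drop out of the triangle identities. *)
Lemma adjunction_edges (A B : qcat) (f : smap B A) (u : smap A B) : adjunction f u ->
  exists (eta : sexp B B 1) (eps : sexp A A 1),
    [/\ src eta = vtx (sid B) /\ tgt eta = vtx (u ∘s f),
      src eps = vtx (f ∘s u) /\ tgt eps = vtx (sid A),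
      triangle (post B f 1 eta) (pre A f 1 eps) (degen (vtx f)) &
      triangle (pre B u 1 eta) (post A u 1 eps) (degen (vtx u))].
Proof.
case=> eta eps tl tr.
have [e etae] := @rep_ex (qexp B B) _ _ eta.
have [d epsd] := @rep_ex (qexp A A) _ _ eps.
exists e, d; split.
- by split; [exact: (rep_src etae)|exact: (rep_tgt etae)].
- by split; [exact: (rep_src epsd)|exact: (rep_tgt epsd)].
- have ra := rep2_eq_r (esym (scomps1 f)) (rep2_whisker_l f etae).
  have rb := rep2_eq_r (scompA f u f) (rep2_eq_l (scomp1s f) (rep2_whisker_r f epsd)).
  apply: (rep2_triangle _ ra rb); rewrite -tl.
  by rewrite /twocell_comp !compA.
- have ra := rep2_eq_r (esym (scomp1s u)) (rep2_whisker_r u etae).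
  have rb := rep2_eq_r (esym (scompA u f u)) (rep2_eq_l (scomps1 u) (rep2_whisker_l u epsd)).
  apply: (rep2_triangle _ ra rb); rewrite -tr.
  by rewrite /twocell_comp !compA.
Qed.

Theorem proposition4p4p2 (A B : qcat) (f : smap B A) (u : smap A B)
    (fu_adj : adjunction f u) :
  exists w : smap (comma f (sid A)) (comma (sid B) u),
    fibred_equivalence (comma_proj f (sid A)) (comma_proj (sid B) u) w.
Proof.
have [eta [eps [[etas etat] [epss epst] tri_f tri_u]]] := adjunction_edges fu_adj.
set E := comma f (sid A); set F := comma (sid B) u.
pose p1 := comma1 f (sid A); pose p0 := comma0 f (sid A).
pose q1 := comma1 (sid B) u; pose q0 := comma0 (sid B) u.
pose psi := comma_edge f (sid A); pose phi := comma_edge (sid B) u.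
have psis : src psi = vtx (f ∘s p0) := src_comma_edge f (sid A).
have psit : tgt psi = vtx p1 := tgt_comma_edge f (sid A).
have phis : src phi = vtx q0 := src_comma_edge (sid B) u.
have phit : tgt phi = vtx (u ∘s q1) := tgt_comma_edge (sid B) u.
have [|wh tw] := @triangle_ex (qexp B E) (pre B p0 1 eta) (post E u 1 psi).
  by rewrite tgt_map src_map etat psis pre_vtx post_vtx; congr vtx; exact: smap_eq.
have whP : src wh = vtx (sid B ∘s p0) /\ tgt wh = vtx (u ∘s p1).
  rewrite -(triangle_src tw) -(triangle_tgt tw) tgt_map src_map etas psit.
  by rewrite pre_vtx post_vtx.
pose w : smap E F := comma_lift whP.
have [|wh' tw'] := @triangle_ex (qexp A F) (post F f 1 phi) (pre A q1 1 eps).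
  by rewrite tgt_map src_map phit epss pre_vtx post_vtx; congr vtx; exact: smap_eq.
have whP' : src wh' = vtx (f ∘s q0) /\ tgt wh' = vtx (sid A ∘s q1).
  rewrite -(triangle_src tw') -(triangle_tgt tw') tgt_map src_map epst phis.
  by rewrite pre_vtx post_vtx.
pose w' : smap F E := comma_lift whP'.
have wphi : pre B w 1 phi = wh by exact: comma_lift_edge.
have wpsi : pre A w' 1 psi = wh' by exact: comma_lift_edge.
exists w; split; first by apply: smap_eq => n [[? []]].
exists w'; split; first by apply: smap_eq => n [[? []]].
- have [D [D1 D2]] := interchange epss epst psis psit.
  apply: (@comma_iso A B A E f (sid A) p0 p1); [exact: smap_eq|by apply: smap_eq => n [[? []]]|].
  have m_eq : pre A (w' ∘s w) 1 psi = pre A w 1 wh' by rewrite -wpsi; exact: smap_eq.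
  have id_eq : pre A (sid E) 1 psi = psi by exact: smap_eq.
  rewrite -/psi m_eq id_eq.
  have t1 := triangle_map (post E f) tw.
  have t2 := triangle_map (pre A w) tw'.
  have e2a : pre A w 1 (post F f 1 phi) = post E f 1 wh by rewrite -wphi; exact: smap_eq.
  have e2b : pre A w 1 (pre A q1 1 eps) = pre A p1 1 eps by exact: smap_eq.
  have e1b : post E f 1 (post E u 1 psi) = post E (f ∘s u) 1 psi by exact: smap_eq.
  have t3 := triangle_map (pre A p0) tri_f.
  have e3a : pre A p0 1 (post B f 1 eta) = post E f 1 (pre B p0 1 eta) by exact: smap_eq.
  have e3b : pre A p0 1 (pre A f 1 eps) = pre A (f ∘s p0) 1 eps by exact: smap_eq.
  have eD : post E (sid A) 1 psi = psi by exact: smap_eq.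
  rewrite e2a e2b in t2; rewrite e1b in t1; rewrite e3a e3b degen_map in t3.
  rewrite eD in D2.
  (* With [eps] natural at [psi] and the identity for [f]: [eps p1 . f u psi . f eta p0 = psi . eps
     f p0 . f eta p0 = psi], where [D] is the diagonal of the naturality square. *)
  have t4 := @triangleA (qexp A E) _ _ _ _ _ _ t1 D1 t2.
  by have /(@homotP (qexp A E)) := @triangleB (qexp A E) _ _ _ _ _ _ t3 D2 t4.
- have [D [D1 D2]] := interchange etas etat phis phit.
  apply: (@comma_iso B B A F (sid B) u q0 q1); [by apply: smap_eq => n [[? []]]|exact: smap_eq|].
  have m_eq : pre B (w ∘s w') 1 phi = pre B w' 1 wh by rewrite -wphi; exact: smap_eq.
  have id_eq : pre B (sid F) 1 phi = phi by exact: smap_eq.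
  rewrite -/phi m_eq id_eq.
  have t1 := triangle_map (post F u) tw'.
  have t2 := triangle_map (pre B w') tw.
  have e2a : pre B w' 1 (pre B p0 1 eta) = pre B q0 1 eta by exact: smap_eq.
  have e2b : pre B w' 1 (post E u 1 psi) = post F u 1 wh' by rewrite -wpsi; exact: smap_eq.
  have e1a : post F u 1 (post F f 1 phi) = post F (u ∘s f) 1 phi by exact: smap_eq.
  have t3 := triangle_map (pre B q1) tri_u.
  have e3a : pre B q1 1 (pre B u 1 eta) = pre B (u ∘s q1) 1 eta by exact: smap_eq.
  have e3b : pre B q1 1 (post A u 1 eps) = post F u 1 (pre A q1 1 eps) by exact: smap_eq.
  have eD : post F (sid B) 1 phi = phi by exact: smap_eq.
  rewrite e2a e2b in t2; rewrite e1a in t1; rewrite e3a e3b degen_map in t3.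
  rewrite eD in D1.
  (* With [eta] natural at [phi] and the identity for [u]: [u eps q1 . u f phi . eta q0 = u eps q1 .
     eta u q1 . phi = phi]. Here the degenerate edge comes last, so the homotopy starts at [phi] and
     gives an edge from the identity to [w w']. *)
  have t4 := @triangleB (qexp B F) _ _ _ _ _ _ D2 t1 t2.
  by have /(@triangle_homot (qexp B F)) := @triangleA (qexp B F) _ _ _ _ _ _ D1 t3 t4.
Qed.
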